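(* Let $r\ge1$ and, for $1\le u\le r$, let $(b^{(u)}_j)_{j\in\mathbb Z}$ be a sequence of bounded i.i.d. real random variables, the $r$ sequences being mutually independent. On $\ell^2(\mathbb Z)$ let $S$ be the bilateral shift, $Se_j=e_{j+1}$, let $B_ue_j=b^{(u)}_je_j$, and let $J_u=SB_u+B_uS^*$. Let $X_{1,N},\dots,X_{r,N}$ be independent zero-diagonal simple tridiagonal models of size $N$ whose respective off-diagonal laws are those of $b^{(1)}_0,\dots,b^{(r)}_0$. Then for every integer $q\ge0$ and every color word $c=(c_1,\dots,c_q)\in\{1,\dots,r\}^q$, $$\operatorname{tr}_N(X_{c_1,N}\cdots X_{c_q,N})\longrightarrow\Phi(J_{c_1}\cdots J_{c_q})=\sum_{\gamma\in\mathcal C_q}\prod_{i\in\mathbb Z}\prod_{u=1}^r\mathbb E\left[(b^{(u)}_0)^{\ell_{i,u}(\gamma,c)}\right]$$ in expectation and almost surely as $N\to\infty$. (Only finitely many factors in the product differ from $1$.)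
   Context: A zero-diagonal simple tridiagonal model with off-diagonal law $\mathcal L(b)$ is the sequence of $N\times N$ real symmetric tridiagonal matrices $X_N$ with zero diagonal and $X_N(N-k,N-k+1)=X_N(N-k+1,N-k)=b_k$ for $1\le k\le N-1$, where $(b_k)_{k\ge1}$ is a single i.i.d. sequence (not depending on $N$) of copies of $b$. The models $X_{1,N},\dots,X_{r,N}$ being independent means their coefficient sequences are independent. $\operatorname{tr}_N=\frac1N\operatorname{Tr}$. $\Phi(A):=\mathbb E\langle e_0,Ae_0\rangle$ for random operators $A$ in the algebra generated by the shift and the coefficient fields. $\mathcal C_q$ is the set of paths $\gamma=(j_0,\dots,j_q)\in\mathbb Z^{q+1}$ with $j_0=j_q=0$ and $|j_s-j_{s-1}|=1$ for $1\le s\le q$. For $\gamma\in\mathcal C_q$, $i\in\mathbb Z$ and a color $u$, $\ell_{i,u}(\gamma,c):=\#\{1\le s\le q:\ c_s=u,\ \{j_{s-1},j_s\}=\{i,i+1\}\}$. *)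

(* Defs.v *)
From HB Require Import structures.
From mathcomp Require Import all_boot all_order all_algebra finmap.
From mathcomp Require Import all_classical all_reals all_analysis.
From mathcomp Require Import ring.

Set Implicit Arguments.
Unset Strict Implicit.
Unset Printing Implicit Defensive.
Import Order.TTheory GRing.Theory Num.Theory.
Import numFieldNormedType.Exports.

Local Open Scope classical_set_scope.
Local Open Scope ring_scope.

Section independence.
Context {d : measure_display} {T : measurableType d} {R : realType}.
Variable P : probability T R.

Definition mutually_independent (K : choiceType) (D : set K)
    (F : K -> set (set T)) : Prop :=
  forall (s : {fset K}) (A : K -> set T),
    [set` s] `<=` D -> (forall k, k \in s -> F k (A k)) ->
    P (\bigcap_(k in [set` s]) A k) = (\prod_(k <- s) P (A k))%E.

Definition sigma_RV (X : T -> R) : set (set T) :=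
  preimage_set_system [set: T] X measurable.

Definition sigma_RVs (I : choiceType) (D : set I) (X : I -> T -> R) :
    set (set T) :=
  <<s \bigcup_(j in D) sigma_RV (X j) >>.

Definition independent_RVs (I : choiceType) (D : set I) (X : I -> T -> R) :=
  mutually_independent D (fun j => sigma_RV (X j)).

Definition independent_sequences (r : nat) (I : choiceType) (D : set I)
    (X : 'I_r -> I -> T -> R) :=
  mutually_independent [set: 'I_r] (fun u => sigma_RVs D (X u)).

End independence.

(* The values of a measure on non-measurable sets are irrelevant, so laws are
   compared on Borel sets only. *)
Definition same_law {d d' : measure_display} {T : measurableType d}
    {T' : measurableType d'} {R : realType}
    (P : probability T R) (P' : probability T' R)
    (X : {RV P >-> R}) (Y : {RV P' >-> R}) : Prop :=
  forall A : set R, measurable A -> distribution P X A = distribution P' Y A.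

Definition iid {d : measure_display} {T : measurableType d} {R : realType}
    (P : probability T R) (I : choiceType) (D : set I)
    (X : I -> {RV P >-> R}) : Prop :=
  independent_RVs P D X /\ (forall j k, D j -> D k -> same_law (X j) (X k)).

Section ell2.
Variable R : realType.
Implicit Types f g : int -> R.

Definition square_summable : {pred (int -> R)} :=
  fun f => `[< summable [set: int] (fun j => (f j ^+ 2)%:E) >].

Lemma square_summableE f : f \in square_summable <->
  (\esum_(j in [set: int]) (f j ^+ 2)%:E < +oo)%E.
Proof.
rewrite unfold_in /square_summable /summable.
rewrite (@eq_esum _ _ _ _ (fun j => (f j ^+ 2)%:E)); first by split=> /asboolP.
by move=> j _; rewrite abse_EFin ger0_norm ?sqr_ge0.
Qed.

Lemma square_summable_submod : submod_closed square_summable.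
Proof.
split=> [|a f g /asboolP sf /asboolP sg].
  apply/square_summableE; rewrite esum1 ?ltry// => j _.
  by rewrite /= expr0n.
apply/square_summableE.
have sZ (c : R) h : summable [set: int] (fun j => (h j ^+ 2)%:E) ->
    (\esum_(j in [set: int]) ((c * h j) ^+ 2)%:E < +oo)%E.
  move/asboolP/square_summableE => sh.
  apply: (@le_lt_trans _ _
    ((c ^+ 2)%:E * \esum_(j in [set: int]) (h j ^+ 2)%:E)%E); last first.
    apply: lte_mul_pinfty => //.
      by rewrite lee_fin sqr_ge0.
  apply: ge_ereal_sup => _ [A [finA _]] <-.
  rewrite fsbig_finite//=.
  under eq_bigr do rewrite exprMn EFinM.
  rewrite -ge0_sume_distrr; last by move=> j _; rewrite lee_fin sqr_ge0.
  apply: lee_wpmul2l; first by rewrite lee_fin sqr_ge0.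
  by apply: ereal_sup_ubound; exists A => //; rewrite fsbig_finite.
apply: (@le_lt_trans _ _
  (\esum_(j in [set: int]) (((2 * a * f j) ^+ 2)%:E + ((2 * g j) ^+ 2)%:E))%E).
  apply: le_esum => j _; rewrite -EFinD lee_fin.
  rewrite [X in X ^+ 2](_ : _ = a * f j + g j)//.
  rewrite -mulrA; set x := a * f j; set y := g j.
  rewrite -subr_ge0 [X in 0 <= X](_ : _ =
    (x - y) ^+ 2 + 2 * (x ^+ 2 + y ^+ 2)); last by ring.
  by apply: addr_ge0; rewrite ?sqr_ge0// mulr_ge0 ?ler0n// addr_ge0 ?sqr_ge0.
rewrite esumD; [|by move=> j _; rewrite lee_fin sqr_ge0..].
by apply: lte_add_pinfty; exact: sZ.
Qed.

HB.instance Definition _ :=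
  GRing.isSubmodClosed.Build R (int -> R) square_summable
    square_summable_submod.

Record ell2 := Ell2 { ell2_fun :> int -> R; _ : ell2_fun \in square_summable }.
HB.instance Definition _ := [isSub for ell2_fun].
HB.instance Definition _ := [Choice of ell2 by <:].
HB.instance Definition _ := [SubChoice_isSubLmodule of ell2 by <:].

Definition dotl2 (f g : ell2) : R :=
  let h := fun j => (f j * g j)%:E in
  fine (\esum_(j in [set: int]) h^\+ j - \esum_(j in [set: int]) h^\- j)%E.

Lemma basis_subproof (i : int) :
  (fun j => (j == i)%:R : R) \in square_summable.
Proof.
apply/square_summableE.
rewrite (esumID [set i]); last by move=> j _; rewrite lee_fin sqr_ge0.
rewrite setTI [X in (_ + X)%E]esum1.
  by rewrite esum_set1 ?lee_fin ?sqr_ge0// eqxx adde0 ltry.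
by move=> j [_ /eqP/negbTE ->]; rewrite expr0n.
Qed.

Definition basis (i : int) : ell2 := Ell2 (basis_subproof i).

Lemma translate_subproof (a : int) (f : ell2) :
  (fun j => f (j + a)) \in square_summable.
Proof.
apply/square_summableE; case: f => f /= /square_summableE.
rewrite (reindex_esum [set: int] [set: int] (fun j => j + a))//.
split=> //; first by move=> x y _ _; exact: addIr.
by move=> y _; exists (y - a) => //; rewrite subrK.
Qed.

Definition shift (f : ell2) : ell2 := Ell2 (translate_subproof (-1) f).

Definition shift_adj (f : ell2) : ell2 := Ell2 (translate_subproof 1 f).

(* insubd returns 0 if the pointwise product is not square-summable; this never
   happens for bounded a, nor for any a on a finitely supported f. *)
Definition diag (a : int -> R) (f : ell2) : ell2 :=
  insubd (0 : ell2) (fun j => a j * f j).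

Definition jacobi (a : int -> R) : ell2 -> ell2 :=
  (shift \o diag a) \+ (diag a \o shift_adj).

Lemma shift_basis i : shift (basis i) = basis (i + 1).
Proof. by apply/val_inj/funext => j /=; rewrite subr_eq. Qed.

Lemma diag_basis a i : diag a (basis i) = a i *: basis i.
Proof.
have e : (fun j => a j * basis i j) = val (a i *: basis i).
  apply/funext => j /=.
  rewrite -[RHS]/(a i * (j == i)%:R).
  by have [->//|ne] := eqVneq j i; rewrite !mulr0.
by rewrite /diag e valKd.
Qed.

Lemma diag_bounded a (C : R) (f : ell2) : (forall j, `|a j| <= C) ->
  diag a f = (fun j => a j * f j) :> (int -> R).
Proof.
move=> aC; rewrite /diag val_insubd ifT//.
have /square_summableE : (C *: (f : int -> R)) \in square_summable.
  by apply: rpredZ; exact: (valP f).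
move=> h; apply/square_summableE; apply: le_lt_trans h.
apply: le_esum => j _; rewrite lee_fin -[leLHS]real_normK ?num_real//.
rewrite -[leRHS]real_normK ?num_real// ler_pXn2r ?nnegrE// !normrM.
by rewrite ler_wpM2r// (le_trans (aC j))// ler_norm.
Qed.

Lemma shift_adjP (f g : ell2) : dotl2 f (shift g) = dotl2 (shift_adj f) g.
Proof.
have b : set_bij [set: int] [set: int] (fun j : int => j + 1).
  split=> //; first by move=> x y _ _; exact: addIr.
  by move=> y _; exists (y - 1) => //; rewrite subrK.
rewrite /dotl2; congr (fine (_ - _)).
  rewrite (reindex_esum [set: int] [set: int] (fun j => j + 1))//.
  by apply: eq_esum => j _; rewrite !funeposE/= addrK.
rewrite (reindex_esum [set: int] [set: int] (fun j => j + 1))//.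
by apply: eq_esum => j _; rewrite !funenegE/= addrK.
Qed.

End ell2.

Definition op_word (R : realType) (r q : nat) (J : 'I_r -> ell2 R -> ell2 R)
    (c : q.-tuple 'I_r) : ell2 R -> ell2 R :=
  \big[(fun A B => A \o B)/id]_(s < q) J (tnth c s).

Definition Phi {d : measure_display} {T : measurableType d} {R : realType}
    (P : probability T R) (A : T -> ell2 R -> ell2 R) : \bar R :=
  ('E_P[fun w => dotl2 (basis R 0) (A w (basis R 0))])%E.

(* Rows and columns are numbered from 0 here and from 1 in the model, so the
   (N - k)-th row is i with i.+1 = N - k, that is k = N - i.+1.  The entry b 0
   is never used. *)
Definition tridiag (R : realType) (b : nat -> R) (N : nat) : 'M[R]_N :=
  \matrix_(i, j)
    if j == i.+1 :> nat then b (N - i.+1)%N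
    else if i == j.+1 :> nat then b (N - j.+1)%N
    else 0.

Definition ntr (R : realType) (N : nat) (A : 'M[R]_N) : R := N%:R^-1 * \tr A.

Definition mx_word (R : realType) (r q N : nat) (X : 'I_r -> 'M[R]_N)
    (c : q.-tuple 'I_r) : 'M[R]_N :=
  \prod_(s < q) X (tnth c s).

Definition closed_paths (q : nat) : set (q.+1.-tuple int) :=
  [set g | [/\ nth 0 g 0 = 0, nth 0 g q = 0 &
    forall s : nat, (s < q)%N -> `|nth 0 g s.+1 - nth 0 g s| = 1] ].

Definition edge_count (r q : nat) (g : q.+1.-tuple int) (c : q.-tuple 'I_r)
    (i : int) (u : 'I_r) : nat :=
  #|[set s : 'I_q | (tnth c s == u) &&
      ([fset nth 0%R g s; nth 0%R g s.+1] == [fset i; (i + 1)%R])%fset]%SET|.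

(* Main.v *)
Require Import Defs.
From HB Require Import structures.
From mathcomp Require Import all_boot all_order all_algebra finmap.
From mathcomp Require Import all_classical all_reals all_analysis.
From mathcomp Require Import measurable_realfun zify ring lra.

Set Implicit Arguments.
Unset Strict Implicit.
Unset Printing Implicit Defensive.
Import Order.TTheory GRing.Theory Num.Theory.
Import numFieldNormedType.Exports.

Local Open Scope classical_set_scope.
Local Open Scope ring_scope.

(** Expanding the matrix product and the operator product along nearest
    neighbour walks turns both sides into sums over closed walks of monomials
    in the coefficients.  Up to O(1) boundary walks, the unnormalised trace is a
    sum over heights [p] of variables [Z p] that are bounded, stationary and
    decorrelated at distance of order [q]; independence factorises the mean of
    each monomial into moments, so each [Z p] has mean the limit.  The variance
    of a sum of [n] terms is then O(n), which gives almost sure convergence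
    along the squares, hence along all integers since the gaps between squares
    are negligible.  Bounded convergence gives convergence of the means.
    Coefficients that are only almost surely bounded are first truncated. *)

(** * Walks *)

(** The model numbers its coefficients from the bottom right corner, so the edge between heights [k]
    and [k + 1] carries the same variable for every size [N]. This is why one fixed sequence [Z]
    serves all sizes, and why a strong law for a single sequence is enough where a triangular array
    might be expected. The model and the limit operator live on unrelated probability spaces. They
    are compared through [limit_moment], which knows the laws only through the moments [mom]: the
    mean of a monomial depends on the colours and multiplicities of its labels, hence is unchanged
    when a walk is translated. Finite matrices are extended by zero weights to all heights, so that
    they obey the same recurrence as the operators on the line and a single expansion covers
    both. *)

Section walks.
Variables (R : comNzRingType) (C : eqType).

Fixpoint sign_words (q : nat) : seq (seq bool) :=
  if q is q'.+1
  then map (cons true) (sign_words q') ++ map (cons false) (sign_words q')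
  else [:: [::]].

Definition step (e : bool) (i : int) : int := if e then i + 1 else i - 1.

(* The edge {i, i + 1} is labelled by its left endpoint i. *)
Definition step_edge (e : bool) (i : int) : int := if e then i else i - 1.

Fixpoint walk_end (i : int) (e : seq bool) : int :=
  if e is x :: e' then walk_end (step x i) e' else i.

Fixpoint walk_edges (i : int) (c : seq C) (e : seq bool) : seq (C * int) :=
  match c, e with
  | u :: c', x :: e' => (u, step_edge x i) :: walk_edges (step x i) c' e'
  | _, _ => [::]
  end.

Definition walk_weight (a : C -> int -> R) (i : int) (c : seq C)
    (e : seq bool) : R :=
  \prod_(k <- walk_edges i c e) a k.1 k.2.

(** Closure is tested from 0 because the displacement of a walk does not depend on its start; all
    starting points thus share one index set and can be compared term by term. *)
Definition closed_walk_sum (a : C -> int -> R) (c : seq C) (i : int) : R :=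
  \sum_(e <- sign_words (size c) | walk_end 0 e == 0) walk_weight a i c e.

Lemma mem_sign_words q e : (e \in sign_words q) = (size e == q).
Proof.
elim: q e => [|q IH] e /=; first by rewrite inE; case: e.
rewrite mem_cat; case: e => [|x e] /=.
  by apply/negbTE/norP; split; apply/mapP => -[].
rewrite eqSS -IH; apply/orP/idP => [[] /mapP[e' ? [_ ->]]//|he].
by case: x; [left|right]; apply/mapP; exists e.
Qed.

Lemma sign_words_uniq q : uniq (sign_words q).
Proof.
elim: q => //= q IH; rewrite cat_uniq !map_inj_uniq ?IH /=; try by move=> ? ? [].
by rewrite andbT; apply/hasPn => _ /mapP[e _ ->]; apply/mapP => -[].
Qed.

Lemma walk_end_add i e : walk_end i e = i + walk_end 0 e.
Proof.
elim: e i => [|x e IH] i /=; first by rewrite addr0.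
by rewrite IH [in RHS]IH addrA; congr (_ + _); rewrite /step; case: x; lia.
Qed.

Lemma size_walk_edges i c e : size e = size c ->
  size (walk_edges i c e) = size c.
Proof. by elim: c e i => [|u c IH] [|x e] i //= [h]; rewrite IH. Qed.

Lemma walk_edges_add i c e :
  walk_edges i c e = [seq (k.1, i + k.2) | k <- walk_edges 0 c e].
Proof.
elim: c e i => [|u c IH] [|x e] i //=.
rewrite IH [in RHS]IH -map_comp; congr ((_, _) :: _).
  by rewrite /step_edge; case: x; lia.
by apply: eq_map => k /=; congr (_, _); rewrite /step; case: x; lia.
Qed.

Lemma walk_edges_range i c e k : k \in walk_edges i c e ->
  i - (size c)%:Z <= k.2 < i + (size c)%:Z.
Proof.
elim: c e i => [|u c IH] [|x e] i //=.
rewrite inE => /predU1P[->|/IH] /=; rewrite ?/step_edge ?/step; case: x; lia.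
Qed.

Lemma walk_weight_cons a i u c x e :
  walk_weight a i (u :: c) (x :: e) =
  a u (step_edge x i) * walk_weight a (step x i) c e.
Proof. by rewrite /walk_weight /= big_cons. Qed.

Lemma eq_walk_weight a a' i c e :
  (forall u k, i - (size c)%:Z <= k < i + (size c)%:Z -> a u k = a' u k) ->
  walk_weight a i c e = walk_weight a' i c e.
Proof.
move=> aa'; rewrite /walk_weight big_seq [RHS]big_seq.
by apply: eq_bigr => k /walk_edges_range; exact: aa'.
Qed.

(** [F c i] stands for coordinate [i] of the word [c] applied to a fixed vector. The leftmost letter
    is the outermost factor, hence the first step of the walk. The recurrence is the only input, so
    operators and matrices are both instances. *)
Lemma walk_expansion (a : C -> int -> R) (F : seq C -> int -> R) :
  (forall u c i, F (u :: c) i = a u i * F c (i + 1) + a u (i - 1) * F c (i - 1)) ->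
  forall c i, F c i =
    \sum_(e <- sign_words (size c)) walk_weight a i c e * F [::] (walk_end i e).
Proof.
move=> Fcons; elim=> [|u c IH] i.
  by rewrite /= big_seq1 /walk_weight big_nil mul1r.
rewrite Fcons /= big_cat !big_map !IH /= !mulr_sumr.
by congr (_ + _); apply: eq_bigr => e _; rewrite walk_weight_cons mulrA.
Qed.

End walks.

(** * Words in the Jacobi operators *)

Section jacobi_expansion.
Variables (R : realType).

(** On finitely supported vectors [diag] never falls back to its default 0, whatever the
    coefficients. This gives the coordinate formula at every sample point, although the coefficients
    are bounded only almost surely. *)
Definition finite_range (f : int -> R) :=
  exists n : nat, forall j : int, (n < `|j|)%N -> f j = 0.

Lemma diag_finite_range (a : int -> R) (f : ell2 R) : finite_range f ->
  diag a f = (fun j => a j * f j) :> (int -> R).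
Proof.
move=> [n fn].
pose a' (j : int) := if (`|j| <= n)%N then a j else 0.
have aa' : (fun j => a j * f j) = (fun j => a' j * f j).
  apply/funext => j; rewrite /a'; case: leqP => // /fn ->.
  by rewrite !mulr0.
rewrite /diag aa' -[insubd _ _]/(diag a' f).
(* Only the values of [a] at labels of absolute value at most [n] matter, and this finite sum
   dominates them all, for both signs of the label. *)
apply: (@diag_bounded R a' (\sum_(k < n.+1) (`|a k| + `|a (- k%:Z)|))) => j.
rewrite /a'; case: leqP => jn; last first.
  by rewrite normr0 sumr_ge0// => k _; rewrite addr_ge0.
have jn' : (`|j| < n.+1)%N by [].
rewrite (bigD1 (Ordinal jn')) //= -[leLHS]addr0 lerD//; last first.
  by rewrite sumr_ge0// => k _; rewrite addr_ge0.
case: j {jn jn'} => m; first by rewrite absz_nat lerDl.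
by rewrite NegzE abszN absz_nat lerDr.
Qed.

Lemma jacobiE (a : int -> R) (f : ell2 R) (i : int) : finite_range f ->
  jacobi a f i = a i * f (i + 1) + a (i - 1) * f (i - 1).
Proof.
move=> ff.
have fs : finite_range (shift_adj f).
  by case: ff => n fn; exists n.+1 => j nj /=; apply: fn; lia.
rewrite -[LHS]/(diag a f (i - 1) + diag a (shift_adj f) i).
by rewrite !diag_finite_range//= addrC.
Qed.

Lemma jacobi_finite_range (a : int -> R) (f : ell2 R) :
  finite_range f -> finite_range (jacobi a f).
Proof.
move=> ff; have [n fn] := ff; exists n.+1 => j nj.
rewrite jacobiE//.
have -> : f (j + 1) = 0 by apply: fn; lia.
have -> : f (j - 1) = 0 by apply: fn; lia.
by rewrite !mulr0 addr0.
Qed.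

Lemma dotl2_basis (i : int) (g : ell2 R) : dotl2 (Defs.basis R i) g = g i.
Proof.
rewrite /dotl2.
have E (h : int -> \bar R) : (forall j, 0 <= h j)%E ->
    (forall j, j != i -> h j = 0%E) -> \esum_(j in [set: int]) h j = h i.
  move=> h0 hi; rewrite (esumID [set i]) ?setTI ?esum_set1//.
  by rewrite esum1 ?adde0// => j ji; apply: hi; exact/eqP.
rewrite !E //=; try by move=> j; rewrite ?funepos_ge0 ?funeneg_ge0.
- rewrite !funeposE !funenegE /= eqxx mul1r.
  case: (leP 0 (g i)) => g0.
    rewrite max_l ?lee_fin// max_r ?sube0//.
    by rewrite lee_fin oppr_le0.
  rewrite max_r ?lee_fin ?(ltW g0)// max_l; last by rewrite lee_fin oppr_ge0 ltW.
  by rewrite add0e /= opprK.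
- move=> j ji; rewrite funenegE /= (negbTE ji) mul0r oppr0.
  by rewrite maxxx.
- by move=> j ji; rewrite funeposE /= (negbTE ji) mul0r maxxx.
Qed.

Lemma op_wordE (r : nat) (J : 'I_r -> ell2 R -> ell2 R) q (c : q.-tuple 'I_r) :
  op_word J c = foldr (fun u g => J u \o g) id c.
Proof.
rewrite /op_word -(big_tuple _ _ c xpredT J).
by elim: (val c) => [|u s IH]; rewrite ?big_nil// big_cons IH.
Qed.

Lemma jacobi_word_closed_walks (r q : nat) (a : 'I_r -> int -> R)
    (c : q.-tuple 'I_r) :
  dotl2 (Defs.basis R 0) (op_word (fun u => jacobi (a u)) c (Defs.basis R 0)) =
  closed_walk_sum a c 0.
Proof.
rewrite dotl2_basis op_wordE.
pose W (s : seq 'I_r) := foldr (fun u g => jacobi (a u) \o g) id s (Defs.basis R 0).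
have Wf s : finite_range (W s).
  elim: s => [|u s IH]; last exact: jacobi_finite_range.
  by exists 0%N => j j0 /=; rewrite (_ : j == 0 = false)//; lia.
rewrite -/(W c) (walk_expansion (a := a) (F := fun s i => W s i)); last first.
  by move=> u s i; rewrite -jacobiE.
rewrite /closed_walk_sum [RHS]big_mkcond /=; apply: eq_bigr => e _.
(* The empty word leaves a coordinate of [basis 0], which is the indicator that the walk has
   closed. *)
by case: eqP => _; rewrite ?mulr1 ?mulr0.
Qed.

End jacobi_expansion.

(** * Words in the tridiagonal matrices *)

Section tridiag_expansion.
Variables (R : realType) (r N : nat).

(* Row [i] sits at height [N - i], so that the edge between heights [k] and
   [k + 1] carries the coefficient [x u k] of the model. *)
Definition height (i : 'I_N) : int := N%:Z - i%:Z.

(** Heights run from 1 to [N], so the inner edges are 1 to [N - 1]. Zero weight on the edges 0 and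
    [N] kills every walk that tries to leave the matrix. *)
Definition cut_weights (x : 'I_r -> nat -> R) (u : 'I_r) (k : int) : R :=
  if 1 <= k < N%:Z then x u `|k|%N else 0.

Lemma height_inj : injective height.
Proof. by move=> i j; rewrite /height => h; apply/val_inj => /=; lia. Qed.

Lemma tridiag_height (x : 'I_r -> nat -> R) u (i j : 'I_N) :
  tridiag (x u) N i j =
    cut_weights x u (height i) * (height j == height i + 1)%:R +
    cut_weights x u (height i - 1) * (height j == height i - 1)%:R.
Proof.
rewrite mxE /cut_weights /height; have := ltn_ord i; have := ltn_ord j.
case: eqP => [ji|ji] jN iN.
  rewrite (_ : (_ == _ + 1) = false) ?mulr0 ?add0r; last by lia.
  rewrite (_ : (_ == _ - 1) = true) ?mulr1; last by lia.
  by rewrite ifT; [congr x; lia|lia].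
case: eqP => [ij|ij].
  rewrite (_ : (_ == _ + 1) = true) ?mulr1; last by lia.
  rewrite (_ : (_ == _ - 1) = false) ?mulr0 ?addr0; last by lia.
  by rewrite ifT; [congr x; lia|lia].
rewrite (_ : (_ == _ + 1) = false) ?mulr0 ?add0r; last by lia.
by rewrite (_ : (_ == _ - 1) = false) ?mulr0; last by lia.
Qed.

Lemma trace_mx_word_walks (q : nat) (x : 'I_r -> nat -> R)
    (c : q.-tuple 'I_r) :
  \tr (mx_word (fun u => tridiag (x u) N) c) =
  \sum_(p < N) closed_walk_sum (cut_weights x) c p.+1%:Z.
Proof.
rewrite /mx_word -(big_tuple _ _ c xpredT (fun u => tridiag (x u) N)).
pose M (s : seq 'I_r) : 'M[R]_N := \prod_(u <- s) tridiag (x u) N.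
rewrite -/(M c).
(* Column [j] of the word as a function of the height, extended by 0 to all integers as
   [walk_expansion] requires. *)
pose F j s (t : int) := \sum_(k < N) (height k == t)%:R * M s k j.
have FM j s k : F j s (height k) = M s k j.
  rewrite /F (bigD1 k) //= eqxx mul1r big1 ?addr0// => l lk.
  by rewrite (inj_eq height_inj) (negbTE lk) mul0r.
have Mcons j u s k : M (u :: s) k j =
    cut_weights x u (height k) * F j s (height k + 1) +
    cut_weights x u (height k - 1) * F j s (height k - 1).
  rewrite /M big_cons -mulmxE mxE /F !mulr_sumr -big_split /=.
  by apply: eq_bigr => l _; rewrite tridiag_height mulrDl !mulrA.
have Fcons j u s i : F j (u :: s) i =
    cut_weights x u i * F j s (i + 1) + cut_weights x u (i - 1) * F j s (i - 1).
  have [/andP[i1 iN]|iout] := boolP (1 <= i <= N%:Z).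
    have hN : (N - `|i| < N)%N by lia.
    have <- : height (Ordinal hN) = i by rewrite /height /=; lia.
    by rewrite FM Mcons.
  (* Outside the heights 1 to [N] no row contributes to the left side, and both cut weights on the
     right vanish. *)
  rewrite {1}/F big1 => [|k _]; last first.
    rewrite (_ : (_ == i) = false) ?mul0r//; apply/negP => /eqP hk.
    by move: iout; rewrite -hk /height; have := ltn_ord k; lia.
  by rewrite /cut_weights !ifF ?mul0r ?addr0//; apply/negP => h; lia.
transitivity (\sum_(j < N) closed_walk_sum (cut_weights x) c (height j)).
  rewrite /mxtrace; apply: eq_bigr => j _.
  rewrite -FM (walk_expansion (a := cut_weights x) (F := F j))//.
  rewrite /closed_walk_sum [RHS]big_mkcond /=; apply: eq_bigr => e _.
  rewrite /F /M big_nil (bigD1 j) //= big1 => [|k kj]; last first.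
    by rewrite mxE (negbTE kj) mulr0.
  rewrite mxE eqxx mulr1 addr0 walk_end_add addrC -subr_eq subrr eq_sym.
  by case: eqP => _; rewrite ?mulr1 ?mulr0.
rewrite (reindex_inj rev_ord_inj) /=; apply: eq_bigr => j _.
by congr closed_walk_sum; rewrite /height /=; have := ltn_ord j; lia.
Qed.

End tridiag_expansion.

(** * Closed paths and edge counts in terms of sign words *)

Section closed_paths_as_walks.

Definition walk_tuple (q : nat) (e : seq bool) : q.+1.-tuple int :=
  mktuple (fun s : 'I_q.+1 => walk_end 0 (take s e)).

Lemma nth_walk_tuple q e s : (s <= q)%N ->
  nth 0 (walk_tuple q e) s = walk_end 0 (take s e).
Proof. by move=> sq; rewrite (nth_mktuple _ _ (Ordinal (sq : s < q.+1)%N)). Qed.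

Lemma walk_end_rcons i e x : walk_end i (rcons e x) = step x (walk_end i e).
Proof. by elim: e i => //= y e IH i. Qed.

Lemma walk_end_takeS i e s : (s < size e)%N ->
  walk_end i (take s.+1 e) = step (nth true e s) (walk_end i (take s e)).
Proof. by move=> se; rewrite (take_nth true)// walk_end_rcons. Qed.

Lemma step_inj x y i : step x i = step y i -> x = y.
Proof. by case: x y => [] []; rewrite /step//; lia. Qed.

Lemma walk_tuple_inj q e e' : size e = q -> size e' = q ->
  walk_tuple q e = walk_tuple q e' -> e = e'.
Proof.
move=> se se' ee'; apply: (@eq_from_nth _ true); rewrite se// => s sq.
have W t : (t <= q)%N -> walk_end 0 (take t e) = walk_end 0 (take t e').
  by move=> tq; rewrite -!(nth_walk_tuple _ tq) ee'.
have := W s.+1 sq; rewrite !walk_end_takeS ?se ?se'// W ?(ltnW sq)//.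
exact: step_inj.
Qed.

Lemma closed_pathsE q : @closed_paths q =
  [set` [seq walk_tuple q e | e <- sign_words q & walk_end 0 e == 0]].
Proof.
apply/seteqP; split=> g /=.
  move=> [g0 gq gs]; pose e := mkseq (fun s => nth 0 g s.+1 == nth 0 g s + 1) q.
  have se : size e = q by rewrite size_mkseq.
  have eg s : (s <= q)%N -> walk_end 0 (take s e) = nth 0 g s.
    elim: s => [_|s IH sq]; first by rewrite take0 g0.
    rewrite walk_end_takeS ?se// IH ?(ltnW sq)// nth_mkseq//.
    move: (gs _ sq); move: (nth 0 g s.+1) (nth 0 g s) => a b.
    by rewrite /step; case: eqP; lia.
  apply/mapP; exists e.
    rewrite mem_filter mem_sign_words se eqxx andbT.
    by rewrite -[e]take_size se eg// gq.
  apply: eq_from_tnth => s; rewrite !(tnth_nth 0) nth_walk_tuple ?eg//;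
  exact: (ltn_ord s).
move=> /mapP[e]; rewrite mem_filter mem_sign_words => /andP[/eqP e0 /eqP se] ->.
split=> [||s sq]; rewrite ?nth_walk_tuple ?(ltnW sq)// ?take0//.
  by rewrite -se take_size.
by rewrite walk_end_takeS ?se// /step; case: nth; lia.
Qed.

Lemma fsbig_closed_paths (R : Type) (idx : R) (op : Monoid.com_law idx) q
    (F : q.+1.-tuple int -> R) :
  \big[op/idx]_(g \in @closed_paths q) F g =
  \big[op/idx]_(e <- sign_words q | walk_end 0 e == 0) F (walk_tuple q e).
Proof.
rewrite closed_pathsE -fsbig_seq; last first.
  rewrite map_inj_in_uniq ?filter_uniq ?sign_words_uniq// => e e'.
  rewrite !mem_filter !mem_sign_words => /andP[_ /eqP se] /andP[_ /eqP se'].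
  exact: walk_tuple_inj.
by rewrite big_map big_filter.
Qed.

Lemma nth_walk_edges (C : eqType) (u0 : C) i c e s : size e = size c ->
  (s < size c)%N -> nth (u0, 0) (walk_edges i c e) s =
    (nth u0 c s, step_edge (nth true e s) (walk_end i (take s e))).
Proof.
by elim: c e i s => [|u c IH] [|x e] i [|s] //= [se] sc; rewrite IH.
Qed.

(** An unoriented edge is determined by its left endpoint, so counting set equalities amounts to
    counting labels. *)
Lemma fset2_edge (x : bool) (i j : int) :
  ([fset j; step x j] == [fset i; (i + 1)%R])%fset = (step_edge x j == i).
Proof.
apply/eqP/eqP => [h|<-]; last first.
  by case: x; rewrite /step /step_edge//= fsetUC subrK.
have : i \in [fset j; step x j]%fset by rewrite h in_fset2 eqxx.
have : i + 1 \in [fset j; step x j]%fset by rewrite h in_fset2 eqxx orbT.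
rewrite !in_fset2 /step /step_edge.
by case: x {h}; move=> /orP[/eqP|/eqP] h1 /orP[/eqP|/eqP] h2; lia.
Qed.

Lemma edge_countE (r q : nat) (c : q.-tuple 'I_r) e i u : size e = q ->
  edge_count (walk_tuple q e) c i u = count_mem (u, i) (walk_edges 0 c e).
Proof.
move=> se; rewrite /edge_count cardsE cardE {1}/enum_mem -enumT.
have sc : size e = size c by rewrite size_tuple.
have -> : walk_edges 0 c e =
    [seq (tnth c s, step_edge (nth true e s) (walk_end 0 (take s e))) | s : 'I_q].
  apply: (@eq_from_nth _ (u, 0)).
    by rewrite size_walk_edges// size_map size_enum_ord size_tuple.
  rewrite size_walk_edges// size_tuple => s sq.
  rewrite nth_walk_edges ?size_tuple// (nth_map (Ordinal sq)) ?size_enum_ord//.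
  by rewrite (nth_ord_enum _ (Ordinal sq)) (tnth_nth u).
rewrite count_map -size_filter; congr size; apply: eq_filter => s.
rewrite [LHS]unfold_in !nth_walk_tuple ?(ltnW (ltn_ord s))//.
rewrite walk_end_takeS ?se// fset2_edge.
by rewrite /= xpair_eqE.
Qed.

End closed_paths_as_walks.

(** * Means of bounded functions *)

Section bounded_expectation.
Context {d : measure_display} {T : measurableType d} {R : realType}.
Variable P : probability T R.
Implicit Types f g : T -> R.

(** The bound is required at every point, so the class is stable under sums and products and
    integrability comes for free. The price is that the coefficients must be truncated. *)
Definition bounded_mfun f :=
  measurable_fun [set: T] f /\ exists M : R, forall w, `|f w| <= M.

Definition mean f : R := (\int[P]_w f w)%R.

Lemma bounded_mfun_integrable f : bounded_mfun f ->
  P.-integrable [set: T] (EFin \o f).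
Proof.
move=> [mf [M fM]]; apply: measurable_bounded_integrable => //.
  by rewrite [ltLHS]probability_setT ltry.
by exists M; split; [exact: num_real|move=> y My w _; exact: le_trans (ltW My)].
Qed.

Lemma expectation_mean f : bounded_mfun f -> 'E_P[f]%E = (mean f)%:E.
Proof.
move=> bf; rewrite unlock /mean /Rintegral fineK//.
exact: integrable_fin_num (bounded_mfun_integrable bf).
Qed.

Lemma bounded_mfun_cst (k : R) : bounded_mfun (fun=> k).
Proof. by split=> //; exists `|k|. Qed.

Lemma bounded_mfunD f g : bounded_mfun f -> bounded_mfun g ->
  bounded_mfun (fun w => f w + g w).
Proof.
move=> [mf [M fM]] [mg [N gN]]; split; first exact: measurable_funD.
by exists (M + N) => w; rewrite (le_trans (ler_normD _ _))// lerD.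
Qed.

Lemma bounded_mfunM f g : bounded_mfun f -> bounded_mfun g ->
  bounded_mfun (fun w => f w * g w).
Proof.
move=> [mf [M fM]] [mg [N gN]]; split; first exact: measurable_funM.
by exists (M * N) => w; rewrite normrM ler_pM.
Qed.

Lemma bounded_mfunZ (k : R) f : bounded_mfun f ->
  bounded_mfun (fun w => k * f w).
Proof. exact/bounded_mfunM/bounded_mfun_cst. Qed.

Lemma bounded_mfunB f g : bounded_mfun f -> bounded_mfun g ->
  bounded_mfun (fun w => f w - g w).
Proof.
move=> bf bg; under eq_fun do rewrite -mulN1r.
exact/bounded_mfunD/bounded_mfunZ.
Qed.

Lemma bounded_mfunX f n : bounded_mfun f -> bounded_mfun (fun w => f w ^+ n).
Proof.
move=> bf; elim: n => [|n IH]; first exact: bounded_mfun_cst.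
by under eq_fun do rewrite exprS; exact: bounded_mfunM.
Qed.

Lemma bounded_mfun_indic (A : set T) : measurable A -> bounded_mfun \1_A.
Proof.
move=> mA; split; first exact: measurable_indic.
by exists 1 => w; rewrite indicE normr_nat; case: (w \in A).
Qed.

Lemma bounded_mfun_sum (I : eqType) (s : seq I) (p : pred I) (F : I -> T -> R) :
  (forall i, i \in s -> bounded_mfun (F i)) ->
  bounded_mfun (fun w => \sum_(i <- s | p i) F i w).
Proof.
elim: s => [|i s IH] bF.
  by under eq_fun do rewrite big_nil; exact: bounded_mfun_cst.
have bs : bounded_mfun (fun w => \sum_(j <- s | p j) F j w).
  by apply: IH => j js; apply: bF; rewrite inE js orbT.
under eq_fun do rewrite big_cons.
by case: (p i) => //; apply: bounded_mfunD bs; apply: bF; rewrite mem_head.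
Qed.

Lemma bounded_mfun_prod (I : eqType) (s : seq I) (F : I -> T -> R) :
  (forall i, i \in s -> bounded_mfun (F i)) ->
  bounded_mfun (fun w => \prod_(i <- s) F i w).
Proof.
elim: s => [|i s IH] bF.
  by under eq_fun do rewrite big_nil; exact: bounded_mfun_cst.
under eq_fun do rewrite big_cons.
apply: bounded_mfunM; first by apply: bF; rewrite mem_head.
by apply: IH => j js; apply: bF; rewrite inE js orbT.
Qed.

Lemma mean_cst (k : R) : mean (fun=> k) = k.
Proof.
by rewrite /mean Rintegral_cst// [X in fine X]probability_setT/= mulr1.
Qed.

Lemma meanD f g : bounded_mfun f -> bounded_mfun g ->
  mean (fun w => f w + g w) = mean f + mean g.
Proof.
by move=> bf bg; apply: RintegralD => //; exact: bounded_mfun_integrable.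
Qed.

Lemma meanZ (k : R) f : bounded_mfun f -> mean (fun w => k * f w) = k * mean f.
Proof.
by move=> bf; apply: RintegralZl => //; exact: bounded_mfun_integrable.
Qed.

Lemma meanB f g : bounded_mfun f -> bounded_mfun g ->
  mean (fun w => f w - g w) = mean f - mean g.
Proof.
by move=> bf bg; apply: RintegralB => //; exact: bounded_mfun_integrable.
Qed.

Lemma mean_sum (I : eqType) (s : seq I) (p : pred I) (F : I -> T -> R) :
  (forall i, i \in s -> bounded_mfun (F i)) ->
  mean (fun w => \sum_(i <- s | p i) F i w) = \sum_(i <- s | p i) mean (F i).
Proof.
elim: s => [|i s IH] bF.
  by rewrite big_nil -[RHS]mean_cst; congr mean; apply/funext => w; rewrite big_nil.
have bs j : j \in s -> bounded_mfun (F j).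
  by move=> js; apply: bF; rewrite inE js orbT.
rewrite big_cons; under [X in mean X]eq_fun do rewrite big_cons.
case: (p i); last exact: IH.
by rewrite meanD ?IH//; [apply: bF; rewrite mem_head|exact: bounded_mfun_sum].
Qed.

Lemma mean_indic (A : set T) : measurable A -> (mean \1_A)%:E = P A.
Proof.
move=> mA; rewrite -expectation_mean; last exact: bounded_mfun_indic.
exact: expectation_indic.
Qed.

Lemma le_mean f g : bounded_mfun f -> bounded_mfun g ->
  (forall w, f w <= g w) -> mean f <= mean g.
Proof.
by move=> bf bg fg; apply: le_Rintegral => //; exact: bounded_mfun_integrable.
Qed.

Lemma mean_bound f (M : R) : bounded_mfun f -> (forall w, `|f w| <= M) ->
  `|mean f| <= M.
Proof.
move=> bf fM; rewrite ler_norml; apply/andP; split.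
  rewrite -[leLHS]mean_cst; apply: le_mean => // [|w].
    exact: bounded_mfun_cst.
  by have := fM w; rewrite ler_norml => /andP[].
rewrite -[leRHS]mean_cst; apply: le_mean => // [|w].
  exact: bounded_mfun_cst.
by have := fM w; rewrite ler_norml => /andP[].
Qed.

Lemma ae_eq_expectation f g : measurable_fun [set: T] f ->
  measurable_fun [set: T] g -> {ae P, forall w, f w = g w} ->
  'E_P[f]%E = 'E_P[g]%E.
Proof.
move=> mf mg fg; rewrite unlock; apply: ae_eq_integral => //.
- exact/measurable_EFinP.
- exact/measurable_EFinP.
- by apply: filterS fg => w fgw _; rewrite fgw.
Qed.

End bounded_expectation.

(** * Independence *)

Section independence_theory.
Context {d : measure_display} {T : measurableType d} {R : realType}.
Variable P : probability T R.

(** The sum counts the integers in [[1, y]], so it is the integer part of [y]. Removing the level 1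
    and replacing [y] by [y - 1] gives the induction. *)
Lemma count_levels (m : nat) (y : R) : 0 <= y <= m%:R ->
  `|y - \sum_(k < m) (k.+1%:R <= y)%R%:R| <= 1.
Proof.
elim: m y => [|m IH] y /andP[y0 ym].
  by rewrite big_ord0 (le_anti (introT andP (conj ym y0))) subrr normr0.
have [y1|y1] := ltP y 1.
  rewrite big1 ?subr0 ?ger0_norm ?(ltW y1)// => k _.
  by rewrite lt_geF// (lt_le_trans y1)// ler1n.
rewrite big_ord_recl y1 opprD addrA.
have -> : \sum_(i < m) ((lift ord0 i).+1%:R <= y)%R%:R =
    \sum_(i < m) (i.+1%:R <= y - 1)%R%:R :> R.
  by apply: eq_bigr => i _; rewrite lerBrDr -natr1.
by apply: IH; rewrite subr_ge0 y1 lerBlDr natr1.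
Qed.

Lemma sigma_RV_measurable (Y : T -> R) (A : set T) :
  measurable_fun [set: T] Y -> sigma_RV Y A -> measurable A.
Proof. by move=> mY [B mB <-]; exact: mY. Qed.

Lemma sigma_RV_ge (Y : T -> R) (a : R) : sigma_RV Y [set w | a <= Y w].
Proof.
exists `[a, +oo[%classic; first exact: measurable_itv.
by apply/seteqP; split=> w /=; rewrite in_itv/= andbT => // -[].
Qed.

Lemma sigma_RV_comp (f : R -> R) (Y : T -> R) : measurable_fun [set: R] f ->
  sigma_RV (f \o Y) `<=` sigma_RV Y.
Proof.
move=> mf _ [B mB <-]; exists (f @^-1` B) => //.
by rewrite -[_ @^-1` _]setTI; exact: mf.
Qed.

(* Both sides are linear in [Y], and [Y] is uniformly approximated by rescaled
   sums of the indicators of its level sets. *)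
Lemma mean_mul_indep (Y G : T -> R) : bounded_mfun Y -> bounded_mfun G ->
  (forall A, sigma_RV Y A ->
     mean P (fun w => \1_A w * G w) = mean P \1_A * mean P G) ->
  mean P (fun w => Y w * G w) = mean P Y * mean P G.
Proof.
move=> bY bG YG; have [mY [C YC]] := bY; have [mG [M GM]] := bG.
pose cov f := mean P (fun w => f w * G w) - mean P f * mean P G.
have covD f g : bounded_mfun f -> bounded_mfun g ->
    cov (fun w => f w + g w) = cov f + cov g.
  move=> bf bg; rewrite /cov meanD//; under eq_fun do rewrite mulrDl.
  by rewrite meanD; [ring|exact: bounded_mfunM..].
have covZ k f : bounded_mfun f -> cov (fun w => k * f w) = k * cov f.
  move=> bf; rewrite /cov meanZ//; under eq_fun do rewrite -mulrA.
  by rewrite meanZ; [ring|exact: bounded_mfunM].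
have covB f g : bounded_mfun f -> bounded_mfun g ->
    cov (fun w => f w - g w) = cov f - cov g.
  move=> bf bg; rewrite /cov meanB//; under eq_fun do rewrite mulrBl.
  by rewrite meanB; [ring|exact: bounded_mfunM..].
have cov_cst k : cov (fun=> k) = 0.
  by rewrite /cov meanZ// mean_cst subrr.
suff /eqP : cov Y = 0 by rewrite subr_eq0 => /eqP.
(* [Z] is [n * Y] shifted to be nonnegative, and [S] is its integer part, whose covariance with [G]
   is 0. As [Z - S] is at most 1 in absolute value, [n * cov Y] stays bounded while [n] grows, which
   forces [cov Y = 0]. *)
have main (n : nat) : n%:R * `|cov Y| <= M + M.
  pose Z w := n%:R * Y w + n%:R * C.
  have Z0 w : 0 <= Z w.
    rewrite /Z -mulrDr mulr_ge0//.
    by have := YC w; rewrite ler_norml => /andP[]; lra.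
  pose m := (Num.truncn (n%:R * (C + C))).+1.
  have Zm w : Z w <= m%:R.
    have : Z w <= n%:R * (C + C).
      rewrite /Z -mulrDr ler_wpM2l//.
      by have := YC w; rewrite ler_norml => /andP[]; lra.
    by move=> /le_trans; apply; apply/ltW; exact: truncnS_gt.
  pose A k := [set w | k.+1%:R <= Z w].
  have sA k : sigma_RV Y (A k).
    have : sigma_RV ((fun y => n%:R * y + n%:R * C) \o Y) (A k).
      exact: sigma_RV_ge.
    apply: sigma_RV_comp; apply: measurable_funD => //.
  pose S w := \sum_(k <- iota 0 m) \1_(A k) w : R.
  have bA k : bounded_mfun (\1_(A k) : T -> R).
    exact/bounded_mfun_indic/(sigma_RV_measurable mY).
  have bS : bounded_mfun S by exact: bounded_mfun_sum.
  have covS : cov S = 0.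
    rewrite /cov /S mean_sum// mulr_suml.
    under eq_fun do rewrite mulr_suml.
    rewrite mean_sum => [|k _]; last exact: bounded_mfunM.
    by rewrite -sumrB big1// => k _; rewrite YG// subrr.
  have bZ : bounded_mfun Z.
    by apply: bounded_mfunD; [exact: bounded_mfunZ|exact: bounded_mfun_cst].
  have ZS w : `|Z w - S w| <= 1.
    rewrite /S (_ : \sum_(_ <- _) _ = \sum_(k < m) (k.+1%:R <= Z w)%R%:R).
      by apply: count_levels; rewrite Z0 Zm.
    rewrite -[iota 0 m]/(index_iota 0 m) big_mkord; apply: eq_bigr => k _.
    by rewrite indicE mem_setE.
  have bZS : bounded_mfun (fun w => Z w - S w) by exact: bounded_mfunB.
  have -> : n%:R * `|cov Y| = `|cov (fun w => Z w - S w)|.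
    rewrite covB// covS subr0 covD; [|exact: bounded_mfunZ|exact: bounded_mfun_cst].
    by rewrite cov_cst addr0 covZ// normrM normr_nat.
  rewrite /cov (le_trans (ler_normB _ _))// lerD//.
    apply: mean_bound => [|w]; first exact: bounded_mfunM.
    by rewrite normrM -[leRHS]mul1r ler_pM.
  rewrite normrM -[leRHS]mul1r ler_pM//; exact: mean_bound.
apply/eqP; rewrite -normr_le0; rewrite leNgt; apply/negP => c0.
have := main (Num.truncn ((M + M) / `|cov Y|)).+1; apply/negP.
by rewrite -ltNge -ltr_pdivrMr//; exact: truncnS_gt.
Qed.

Lemma mutually_independent_seq (K : choiceType) (D : set K)
    (F : K -> set (set T)) (s : seq K) (A : K -> set T) :
  mutually_independent P D F -> uniq s -> [set` s] `<=` D ->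
  (forall k, k \in s -> F k (A k)) ->
  P (\bigcap_(k in [set` s]) A k) = (\prod_(k <- s) P (A k))%E.
Proof.
move=> ind us sD FA.
have eqs : [set` [fset k in s]%fset] = [set` s].
  by apply/seteqP; split=> k /=; rewrite inE.
have := ind [fset k in s]%fset A; rewrite eqs => -> //.
  apply: perm_big; apply: uniq_perm => // k.
  by rewrite inE.
by move=> k; rewrite inE; exact: FA.
Qed.

Lemma independent_RVs_comp (K : choiceType) (D : set K) (X : K -> T -> R)
    (f : K -> R -> R) : (forall k, measurable_fun [set: R] (f k)) ->
  independent_RVs P D X -> independent_RVs P D (fun k => f k \o X k).
Proof.
move=> mf ind s A sD sA; apply: ind => // k ks.
exact/(sigma_RV_comp (mf k))/sA.
Qed.

Lemma mean_prod_indep (K : choiceType) (D : set K) (Y : K -> T -> R)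
    (s : seq K) : independent_RVs P D Y -> (forall k, bounded_mfun (Y k)) ->
  uniq s -> [set` s] `<=` D ->
  mean P (fun w => \prod_(k <- s) Y k w) = \prod_(k <- s) mean P (Y k).
Proof.
move=> ind bY.
(* The variables are replaced one at a time by indicators. *)
suff H t A : uniq (s ++ t) -> [set` s ++ t] `<=` D ->
    (forall k, k \in t -> sigma_RV (Y k) (A k)) ->
    mean P (fun w => (\prod_(k <- s) Y k w) * \prod_(k <- t) \1_(A k) w) =
    (\prod_(k <- s) mean P (Y k)) * \prod_(k <- t) mean P \1_(A k).
  move=> us sD; have := H [::] (fun=> set0); rewrite cats0 !big_nil mulr1 => <- //.
  by congr mean; apply/funext => w; rewrite big_nil mulr1.
have bA (t' : seq K) (A' : K -> set T) k :
    (forall k, k \in t' -> sigma_RV (Y k) (A' k)) -> k \in t' ->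
    bounded_mfun (\1_(A' k) : T -> R).
  move=> tA kt; apply/bounded_mfun_indic/(sigma_RV_measurable (Y := Y k)).
    by have [] := bY k.
  exact: tA.
elim: s t A => [|k s IH] t A us sD tA.
  rewrite big_nil mul1r; under eq_fun do rewrite big_nil mul1r.
  have mA k : k \in t -> measurable (A k).
    by move=> kt; apply: (sigma_RV_measurable (Y := Y k)); [case: (bY k)|exact: tA].
  (* Once only indicators remain, their product is the indicator of an intersection and the
     independence of events applies. *)
  have -> : (fun w => \prod_(k <- t) \1_(A k) w) =
      \1_(\bigcap_(k in [set` t]) A k) :> (T -> R).
    apply/funext => w; rewrite indicE; have [/set_mem wA|/negP wA] := boolP (w \in _).
      rewrite big_seq big1// => k kt; rewrite indicE mem_set//; exact: wA.
    have [k kt wk] : exists2 k, k \in t & ~ A k w.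
      apply: contrapT => h; apply: wA; apply/mem_set => k /= kt.
      by apply: contrapT => wk; apply: h; exists k.
    rewrite (big_rem k kt) /= indicE memNset// mul0r//.
  apply: EFin_inj; rewrite mean_indic; last first.
    by apply: fin_bigcap_measurable => //; exact: finite_seq.
  rewrite (mutually_independent_seq ind)// -prodEFin big_seq [RHS]big_seq.
  by apply: eq_bigr => k kt; rewrite -mean_indic//; exact: mA.
have [kst us'] : k \notin s ++ t /\ uniq (s ++ t) by move: us => /= /andP[].
have sD' : [set` s ++ t] `<=` D.
  by move=> j js; apply: sD; rewrite /= inE (js : j \in _) orbT.
pose G w := (\prod_(k <- s) Y k w) * \prod_(k <- t) \1_(A k) w.
have bG : bounded_mfun G.
  by apply: bounded_mfunM; apply: bounded_mfun_prod => // j; exact: bA.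
under eq_fun do rewrite big_cons -mulrA.
rewrite big_cons -mulrA -IH// -[LHS]/(mean P (fun w => Y k w * G w)).
apply: mean_mul_indep => // B sB.
(* The indicator of [B] joins the list [t] at index [k], so that the induction hypothesis applies to
   [k :: t]; since [k] is not in [t], the other sets are unchanged. *)
pose A' j := if j == k then B else A j.
have A't j : j \in t -> A' j = A j.
  rewrite /A'; case: eqP => // -> kt.
  by move: kst; rewrite mem_cat kt orbT.
have -> : (fun w => \1_B w * G w) =
    (fun w => (\prod_(k <- s) Y k w) * \prod_(j <- k :: t) \1_(A' j) w).
  apply/funext => w; rewrite big_cons {1}/A' eqxx mulrCA; congr (_ * (_ * _)).
  by rewrite big_seq [RHS]big_seq; apply: eq_bigr => j jt; rewrite A't.
have perm : perm_eq (s ++ k :: t) (k :: s ++ t).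
  by rewrite -cat1s perm_catCA.
rewrite IH.
- rewrite big_cons {1}/A' eqxx mulrCA /G IH//; congr (_ * (_ * _)).
  by rewrite big_seq [RHS]big_seq; apply: eq_bigr => j jt; rewrite A't.
- by rewrite (perm_uniq perm).
- by move=> j /=; rewrite (perm_mem perm); exact: sD.
- move=> j; rewrite inE => /predU1P[->|jt]; first by rewrite /A' eqxx.
  by rewrite A't//; exact: tA.
Qed.

Lemma sigma_algebra_finite_bigcap (G : set (set T)) (K : eqType) (s : seq K)
    (A : K -> set T) : sigma_algebra [set: T] G ->
  (forall k, k \in s -> G (A k)) -> G (\bigcap_(k in [set` s]) A k).
Proof.
move=> [G0 GC GU]; elim: s => [|k s IH] GA.
  rewrite set_nil bigcap_set0 -[X in G X]setD0; exact: GC.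
have -> : \bigcap_(j in [set` k :: s]) A j = A k `&` \bigcap_(j in [set` s]) A j.
  apply/seteqP; split=> w.
    move=> wA; split=> [|j js]; apply: wA; rewrite /= ?mem_head//.
    by rewrite inE (js : j \in s) orbT.
  by move=> [wk ws] j /=; rewrite inE => /predU1P[->//|js]; exact: ws.
rewrite -[X in G X]setCK setCI -setTD; apply/GC.
rewrite -bigcup2E; apply: GU => -[|[|n]] /=; rewrite -?setTD//.
  by apply/GC/GA; rewrite mem_head.
by apply/GC/IH => j js; apply: GA; rewrite inE js orbT.
Qed.

(** Events are grouped by colour. Each group intersects to an event of the sigma-algebra of its
    sequence, so the probability factors first across colours, then within each colour. *)
Lemma independent_RVs_joint (r : nat) (I : choiceType) (D : set I)
    (X : 'I_r -> I -> T -> R) :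
  (forall u, independent_RVs P D (X u)) -> independent_sequences P D X ->
  independent_RVs P [set k : 'I_r * I | D k.2] (fun k => X k.1 k.2).
Proof.
move=> indu inds s A sD sA.
pose su u := [seq k.2 | k <- s & k.1 == u].
have mem_su u i : (i \in su u) = ((u, i) \in s).
  apply/mapP/idP => [[k]|uis]; last by exists (u, i) => //; rewrite mem_filter eqxx.
  by rewrite mem_filter => /andP[/eqP <- ks] ->; rewrite -surjective_pairing.
have usu u : uniq (su u).
  rewrite map_inj_in_uniq ?filter_uniq ?fset_uniq// => -[u1 i1] [u2 i2].
  by rewrite !mem_filter /= => /andP[/eqP -> _] /andP[/eqP -> _] ->.
pose B u := \bigcap_(i in [set` su u]) A (u, i).
have -> : \bigcap_(k in [set` s]) A k = \bigcap_(u in [set` enum 'I_r]) B u.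
  apply/seteqP; split=> [w wA u _ i /=|w wB [u i] /= uis].
    by rewrite mem_su; exact: wA.
  by apply: (wB u) => /=; rewrite ?mem_enum ?mem_su.
rewrite (mutually_independent_seq inds) ?enum_uniq//; last first.
  move=> u _; apply: sigma_algebra_finite_bigcap.
    exact: smallest_sigma_algebra.
  move=> i; rewrite mem_su => uis; apply: sub_sigma_algebra.
  by exists i; [exact: (sD (u, i))|exact: (sA (u, i))].
rewrite (partition_big (fun k => k.1) xpredT)//= -big_enum /=.
apply: eq_bigr => u _.
rewrite (mutually_independent_seq (indu u)) ?usu//; last first.
- by move=> i; rewrite mem_su; exact: (sA (u, i)).
- by move=> i /=; rewrite mem_su; exact: (sD (u, i)).
rewrite big_map big_filter; apply: eq_bigr => -[u' i] /= /eqP ->//.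
Qed.

End independence_theory.

(** * Means of monomials in independent variables *)

Section joint_moments.
Variables (R : comNzRingType) (C : eqType) (mom : C -> nat -> R).
Hypothesis mom0 : forall u, mom u 0 = 1.

(** The mean of the monomial with index list [s] when the variables are independent and their laws
    depend on the colour only: repetitions in [s] become exponents. *)
Definition joint_moment (I : eqType) (s : seq (C * I)) : R :=
  \prod_(k <- undup s) mom k.1 (count_mem k s).

Lemma joint_moment_widen (I : eqType) (s F : seq (C * I)) :
  uniq F -> {subset s <= F} ->
  joint_moment s = \prod_(k <- F) mom k.1 (count_mem k s).
Proof.
move=> uF sF; rewrite (bigID (mem s)) /= [X in _ * X]big1 ?mulr1; last first.
  by move=> k /count_memPn ->; exact: mom0.
rewrite -big_filter; apply: perm_big; apply: uniq_perm.
- exact: undup_uniq.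
- exact: filter_uniq.
- by move=> k; rewrite mem_undup mem_filter /=; case: (boolP (k \in s)) => // /sF.
Qed.

(** Injective relabelling keeps multiplicities. This yields stationarity, via translations of walks,
    and the passage from positive integer labels to the natural indices of the model. *)
Lemma joint_moment_map (I I' : eqType) (h : C * I -> C * I')
    (s : seq (C * I)) : {in s &, injective h} -> (forall k, (h k).1 = k.1) ->
  joint_moment (map h s) = joint_moment s.
Proof.
move=> hinj h1.
rewrite (@joint_moment_widen _ (map h s) (map h (undup s))); first last.
- by move=> _ /mapP[k ks ->]; apply: map_f; rewrite mem_undup.
- rewrite map_inj_in_uniq ?undup_uniq// => k j.
  by rewrite !mem_undup; exact: hinj.
rewrite big_map [LHS]big_seq [RHS]big_seq; apply: eq_bigr => k.
rewrite mem_undup => ks; rewrite h1 count_map; congr mom.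
apply: eq_in_count => j js /=; apply/eqP/eqP => [|->//].
exact: hinj.
Qed.

(** Source of decorrelation: walks without a common label have factorising joint moments. *)
Lemma joint_moment_cat (I : eqType) (s t : seq (C * I)) :
  (forall k, k \in s -> k \in t -> False) ->
  joint_moment (s ++ t) = joint_moment s * joint_moment t.
Proof.
move=> st; rewrite (@joint_moment_widen _ (s ++ t) (undup s ++ undup t)).
- rewrite big_cat /=; congr (_ * _); rewrite big_seq [RHS]big_seq;
    apply: eq_bigr => k; rewrite mem_undup => kI; rewrite count_cat; congr mom.
    have /count_memPn -> : k \notin t by apply/negP; exact: st.
    by rewrite addn0.
  by have /count_memPn -> : k \notin s by apply/negP => ks; exact: st kI.
- rewrite cat_uniq !undup_uniq andbT /=; apply/hasPn => k.
  by rewrite /= !mem_undup => kt; apply/negP => ks; exact: st kt.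
- by move=> k; rewrite !mem_cat !mem_undup.
Qed.

End joint_moments.

Lemma mean_prod_joint_moment {d : measure_display} {T : measurableType d}
    {R : realType} (P : probability T R) (C I : choiceType)
    (mom : C -> nat -> R) (D : set (C * I)) (X : C * I -> T -> R)
    (s : seq (C * I)) :
  independent_RVs P D X -> (forall k, bounded_mfun (X k)) ->
  (forall k n, D k -> mean P (fun w => X k w ^+ n) = mom k.1 n) ->
  [set` s] `<=` D ->
  mean P (fun w => \prod_(k <- s) X k w) = joint_moment mom s.
Proof.
move=> ind bX Xmom sD.
pose f k (y : R) := y ^+ count_mem k s.
have -> : (fun w => \prod_(k <- s) X k w) =
    (fun w => \prod_(k <- undup s) (f k \o X k) w).
  apply/funext => w.
  rewrite -(big_undup_iterop_count _ s xpredT (fun k => X k w)).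
  by apply: eq_bigr => k _.
rewrite (@mean_prod_indep _ _ _ _ _ D (fun k => f k \o X k)).
- rewrite /joint_moment [LHS]big_seq [RHS]big_seq; apply: eq_bigr => k.
  by rewrite mem_undup => ks; apply: Xmom; exact: sD.
- by apply: independent_RVs_comp ind => k; exact: exprn_measurable.
- by move=> k; exact: bounded_mfunX.
- exact: undup_uniq.
- by move=> k /=; rewrite mem_undup; exact: sD.
Qed.

(** * A strong law for weakly dependent variables *)

Section weak_dependence.
Context {R : realType}.

Lemma sum_ltn_ord (n D : nat) : (\sum_(i < n) (i < D) <= D)%N.
Proof.
apply: (@leq_trans (minn n D)); last exact: geq_minr.
elim: n => [|n IH]; rewrite ?big_ord0// big_ord_recr /=.
by move: IH; move: (\sum_(i < n) _)%N => t; have [] := ltnP n D; lia.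
Qed.

Lemma sum_leq_addn_ord (n D : nat) : (\sum_(i < n) (n <= i + D) <= D)%N.
Proof.
rewrite (reindex_inj rev_ord_inj) /= (leq_trans _ (sum_ltn_ord n D))//.
by apply: leq_sum => i _; case: leqP; case: ltnP => //; have := ltn_ord i; lia.
Qed.

Lemma square_bracket (N : nat) : exists m, (m ^ 2 <= N < m.+1 ^ 2)%N.
Proof.
elim: N => [|N [m /andP[m1 m2]]]; first by exists 0%N.
have [h|h] := ltnP N.+1 (m.+1 ^ 2); first by exists m; rewrite h ltnW.
by exists m.+1; rewrite h /= (leq_ltn_trans m2)// ltn_exp2r.
Qed.

(* The gap between consecutive squares is of smaller order than the squares. *)
Lemma cvg_average_of_squares (y : nat -> R) (K : R) :
  (forall i, `|y i| <= K) ->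
  (n.+1 ^ 2)%:R^-1 * \sum_(i < n.+1 ^ 2) y i @[n --> \oo] --> 0 ->
  n%:R^-1 * \sum_(i < n) y i @[n --> \oo] --> 0.
Proof.
move=> yK /cvgr0Pnorm_lt sq; apply/cvgr0Pnorm_lt => eps eps0.
have K0 : 0 <= K := le_trans (normr_ge0 _) (yK 0%N).
have [n0 _ sqn0] := sq _ (divr_gt0 eps0 (ltr0n R 2)).
(* Between the squares of [m] and [m + 1] lie at most [2 * m] further terms. Their total, at most
   [2 * K * m], is below [eps / 2] times the square of [m] once [4 * K <= eps * m]. *)
pose n1 := (Num.truncn (4 * K / eps)).+1.
have Kn1 (m : nat) : (n1 <= m)%N -> 4 * K <= eps * m%:R.
  move=> n1m; rewrite -ler_pdivrMl// [leLHS]mulrC.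
  apply: ltW; apply: lt_le_trans (truncnS_gt _) _.
  by rewrite ler_nat.
exists ((n0 + n1).+1 ^ 2)%N => // N /= Nn.
have [m /andP[m1 m2]] := square_bracket N.
have nm : (n0 + n1 < m)%N.
  by have := leq_ltn_trans Nn m2; rewrite ltn_exp2r.
case: m => // m in m1 m2 nm *.
have N0 : 0 < N%:R :> R.
  by rewrite ltr0n (leq_trans _ m1)// expn_gt0.
have m0 : 0 < (m.+1 ^ 2)%:R :> R by rewrite ltr0n expn_gt0.
rewrite normrM normfV normr_nat mulrC ltr_pdivrMr//.
have -> : \sum_(i < N) y i = \sum_(i < m.+1 ^ 2) y i + \sum_(m.+1 ^ 2 <= i < N) y i.
  by rewrite -!(big_mkord xpredT y) -big_cat_nat.
apply: (le_lt_trans (ler_normD _ _)).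
have h1 : `|\sum_(i < m.+1 ^ 2) y i| < eps / 2 * (m.+1 ^ 2)%:R.
  have := sqn0 m; rewrite normrM normfV normr_nat mulrC ltr_pdivrMr//.
  by apply; rewrite /= (leq_trans (leq_addr n1 n0))// -ltnS.
have h2 : `|\sum_(m.+1 ^ 2 <= i < N) y i| <= K * (2 * m.+1%:R).
  apply: (le_trans (ler_norm_sum _ _ _)).
  apply: (@le_trans _ _ (\sum_(m.+1 ^ 2 <= i < N) K)); first exact: ler_sum.
  rewrite sumr_const_nat -[K *+ _]mulr_natr ler_wpM2l// -natrM ler_nat.
  by move: m1 m2; rewrite !expnS !expn0; nia.
have h3 := Kn1 m.+1 (leq_trans (leq_addl n0 n1) (ltnW nm)).
have h4 : (m.+1 ^ 2)%:R <= N%:R :> R by rewrite ler_nat.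
have h5 : K * (2 * m.+1%:R) <= eps / 2 * (m.+1 ^ 2)%:R.
  have := ler_wpM2r (ler0n R m.+1) h3.
  by rewrite natrX; lra.
have h6 : eps / 2 * (m.+1 ^ 2)%:R <= eps / 2 * N%:R.
  by rewrite ler_wpM2l// ltW// divr_gt0.
by lra.
Qed.

Context {d : measure_display} {T : measurableType d}.
Variables (P : probability T R) (Y : nat -> T -> R) (K : R) (D : nat).
Hypothesis mY : forall i, measurable_fun [set: T] (Y i).
Hypothesis YK : forall i w, `|Y i w| <= K.
Hypothesis Yorth : forall i j, (i + D <= j)%N ->
  mean P (fun w => Y i w * Y j w) = 0.

Let bY i : bounded_mfun (Y i). Proof. by split=> //; exists K. Qed.

Let S n w := \sum_(i < n) Y i w.

Let bS n : bounded_mfun (S n). Proof. exact: bounded_mfun_sum. Qed.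

Let S_recr n w : S n.+1 w = S n w + Y n w.
Proof. exact: big_ord_recr. Qed.

(** At most [D] indices lie close enough to [n] to correlate with [Y n], and each contributes at
    most [K ^+ 2]. *)
Lemma mean_partial_sum_mul n : `|mean P (fun w => S n w * Y n w)| <= D%:R * K ^+ 2.
Proof.
under eq_fun do rewrite mulr_suml.
rewrite mean_sum => [|i _]; last exact: bounded_mfunM.
rewrite (le_trans (ler_norm_sum _ _ _))//.
apply: (@le_trans _ _ (\sum_(i < n) (n < i + D)%N%:R * K ^+ 2)).
  apply: ler_sum => i _; have [niD|iDn] := ltnP n (i + D).
    rewrite mul1r; apply: mean_bound => [|w]; first exact: bounded_mfunM.
    by rewrite normrM expr2 ler_pM.
  by rewrite Yorth// normr0 mul0r.
rewrite -mulr_suml -natr_sum ler_wpM2r ?sqr_ge0// ler_nat.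
rewrite (leq_trans _ (sum_leq_addn_ord n D))//.
by apply: leq_sum => i _; case: ltnP => // /ltnW ->.
Qed.

(** Adding [Y n] to the sum costs a cross term of at most [2 * D * K ^+ 2] and a square of at most
    [K ^+ 2], whence the factor [2 * D + 1]. *)
Lemma mean_square_partial_sum n :
  mean P (fun w => S n w ^+ 2) <= n%:R * ((D.*2.+1)%:R * K ^+ 2).
Proof.
elim: n => [|n IH].
  rewrite mul0r (_ : (fun w => _) = fun=> 0) ?mean_cst//.
  by apply/funext => w; rewrite /S big_ord0 expr0n.
have -> : (fun w => S n.+1 w ^+ 2) =
    (fun w => S n w ^+ 2 + (2 * (S n w * Y n w) + Y n w ^+ 2)).
  by apply/funext => w; rewrite S_recr; ring.
have bSY : bounded_mfun (fun w => S n w * Y n w) by exact: bounded_mfunM.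
have bY2 : bounded_mfun (fun w => Y n w ^+ 2) by exact: bounded_mfunX.
rewrite !meanD ?meanZ//; last 3 first.
- exact: bounded_mfunZ.
- exact: bounded_mfunX.
- by apply: bounded_mfunD => //; exact: bounded_mfunZ.
have h1 := mean_partial_sum_mul n.
have h2 : `|mean P (fun w => Y n w ^+ 2)| <= K ^+ 2.
  by apply: mean_bound => // w; rewrite normrX ler_pXn2r ?nnegrE ?(le_trans _ (YK n w)).
move: IH h1 h2; rewrite !ler_norml => IH /andP[_ h1] /andP[_ h2].
have -> : n.+1%:R * (D.*2.+1%:R * K ^+ 2) =
    n%:R * (D.*2.+1%:R * K ^+ 2) + (2 * (D%:R * K ^+ 2) + K ^+ 2).
  by rewrite -[in LHS]natr1 -[D.*2.+1%:R]natr1 -muln2 natrM; ring.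
by lra.
Qed.

Let V n w := ((n.+1 ^ 2)%:R^-1 * S (n.+1 ^ 2) w) ^+ 2.

(** The means of [V n] are summable, so the series of the [V n] has finite integral. It is then
    finite almost everywhere, and its terms tend to 0. *)
Lemma ae_cvg_average_squares :
  {ae P, forall w, (n.+1 ^ 2)%:R^-1 * S (n.+1 ^ 2) w @[n --> \oo] --> 0}.
Proof.
pose B := D.*2.+1%:R * K ^+ 2.
have B0 : 0 <= B by rewrite mulr_ge0// sqr_ge0.
have bV n : bounded_mfun (V n) by apply: bounded_mfunX; exact: bounded_mfunZ.
have V0 n w : 0 <= V n w by exact: sqr_ge0.
have mEV n : measurable_fun [set: T] (EFin \o V n).
  by apply/measurable_EFinP; case: (bV n).
(* The natural bound is [B] over the square of [n + 1]; it is relaxed to a telescoping difference so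
   that partial sums stay below [2 * B]. *)
have mV n : mean P (V n) <= 2 * B * (n.+1%:R^-1 - n.+2%:R^-1).
  rewrite /V; under eq_fun do rewrite exprMn.
  rewrite meanZ; last exact: bounded_mfunX.
  have := mean_square_partial_sum (n.+1 ^ 2); rewrite -/B => h.
  have a0 : 0 < n.+1%:R :> R by rewrite ltr0n.
  apply: (le_trans (ler_wpM2l (sqr_ge0 _) h)).
  rewrite natrX -[n.+2%:R]natr1; set a := n.+1%:R in a0 *.
  have a1 : 1 <= a by rewrite /a ler1n.
  rewrite [leLHS](_ : _ = B * (a ^+ 2)^-1); last by field; rewrite gt_eqF.
  rewrite [leRHS](_ : _ = B * (2 / (a * (a + 1)))); last first.
    by field; rewrite !gt_eqF// ltr_wpDr.
  apply: ler_wpM2l => //; rewrite -[leLHS]mul1r.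
  rewrite ler_pdivrMr ?exprn_gt0// mulrAC ler_pdivlMr; last first.
    by rewrite mulr_gt0// ltr_wpDr.
  by nra.
have sumV : (\int[P]_w \sum_(0 <= n <oo) (V n w)%:E <= (2 * B)%:E)%E.
  rewrite integral_nneseries//; last by move=> n w _; rewrite lee_fin.
  apply: lime_le.
    apply: is_cvg_nneseries => n _ _; apply: integral_ge0 => w _.
    by rewrite lee_fin.
  apply: nearW => n.
  apply: (@le_trans _ _ (\sum_(0 <= k < n) (2 * B * (k.+1%:R^-1 - k.+2%:R^-1))%:E)%E).
    apply: lee_sum => k _.
    by have := expectation_mean P (bV k); rewrite unlock => ->; rewrite lee_fin.
  rewrite sumEFin lee_fin -mulr_sumr (ler_piMr (mulr_ge0 _ B0))//.
  under eq_bigr do rewrite -opprB.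
  rewrite sumrN (telescope_sumr (fun k => k.+1%:R^-1))// opprB invr1.
  by rewrite lerBlDr lerDl invr_ge0.
have : P.-integrable [set: T] (fun w => \sum_(0 <= n <oo) (V n w)%:E)%E.
  apply/integrableP; split.
    apply: (ge0_emeasurable_sum (P := xpredT)) => [n w _ _|n _].
      by rewrite lee_fin.
    exact: mEV.
  under eq_integral.
    move=> w _; rewrite gee0_abs; last first.
      by apply: nneseries_ge0 => n _ _; rewrite lee_fin.
    over.
  exact: le_lt_trans sumV (ltry _).
move=> /integrable_ae => /(_ measurableT); apply: filterS => w /(_ I) finV.
have : summable [set x | xpredT x] (fun n => (V n w)%:E).
  rewrite /summable -nneseries_esum//.
  under eq_eseriesr do rewrite gee0_abs ?lee_fin//.
  by rewrite ltey_eq finV.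
move=> /summable_cvg => /(_ (fun n _ => V0 n w)) /cvg_series_cvg_0 /=.
move=> /cvgr0Pnorm_lt VP; apply/cvgr0Pnorm_lt => eps eps0.
have [n0 _ h] := VP (eps ^+ 2) (exprn_gt0 _ eps0).
exists n0 => // n n0n; have := h n n0n.
by rewrite /V normrX ltr_pXn2r ?nnegrE// ltW.
Qed.

Lemma slln_weakly_dependent :
  {ae P, forall w, n%:R^-1 * \sum_(i < n) Y i w @[n --> \oo] --> 0}.
Proof.
apply: filterS ae_cvg_average_squares => w cv.
exact: (cvg_average_of_squares (fun i => YK i w) cv).
Qed.

End weak_dependence.

(** * The model *)

Section limit_moment.
Variables (R : realType) (r : nat).

Definition limit_moment (mom : 'I_r -> nat -> R) (c : seq 'I_r) : R :=
  \sum_(e <- sign_words (size c) | walk_end 0 e == 0)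
    joint_moment mom (walk_edges 0 c e).

(** The right side is the number of closed sign words times [C ^+ size c], a bound uniform in the
    start and in the weights. *)
Lemma closed_walk_sum_bound (C : R) (a : 'I_r -> int -> R) c i :
  (forall u k, `|a u k| <= C) ->
  `|closed_walk_sum a c i| <= closed_walk_sum (fun _ _ => C) c 0.
Proof.
move=> aC; rewrite (le_trans (ler_norm_sum _ _ _))//; apply: ler_sum => e _.
rewrite /walk_weight walk_edges_add big_map normr_prod.
by apply: ler_prod => k _; rewrite normr_ge0 aC.
Qed.

Lemma measurable_closed_walk_sum {d : measure_display} {T : measurableType d}
    (a : T -> 'I_r -> int -> R) c i :
  (forall u k, measurable_fun [set: T] (fun w => a w u k)) ->
  measurable_fun [set: T] (fun w => closed_walk_sum (a w) c i).
Proof.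
move=> ma; rewrite /closed_walk_sum.
under eq_fun do rewrite -big_filter.
by apply: measurable_sum => e; apply: measurable_prod => k _.
Qed.

Lemma ntr_mx_word_walks (q N : nat) (x : 'I_r -> nat -> R)
    (c : q.-tuple 'I_r) :
  ntr (mx_word (fun u => tridiag (x u) N) c) =
  N%:R^-1 * \sum_(p < N) closed_walk_sum (cut_weights N x) c p.+1%:Z.
Proof. by rewrite /ntr trace_mx_word_walks. Qed.

Lemma measurable_ntr_mx_word {d : measure_display} {T : measurableType d}
    (q N : nat) (x : 'I_r -> nat -> T -> R) (c : q.-tuple 'I_r) :
  (forall u k, measurable_fun [set: T] (x u k)) ->
  measurable_fun [set: T]
    (fun w => ntr (mx_word (fun u => tridiag (fun k => x u k w) N) c)).
Proof.
move=> mx; under eq_fun do rewrite ntr_mx_word_walks.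
apply: measurable_funM => //; apply: measurable_sum => p.
apply: measurable_closed_walk_sum => u k; rewrite /cut_weights.
by case: (1 <= k < N%:Z).
Qed.

End limit_moment.

(** * Convergence for coefficients bounded everywhere *)

Section bounded_model.
Context {d : measure_display} {T : measurableType d} {R : realType}.
Variables (P : probability T R) (r : nat) (y : 'I_r -> nat -> T -> R) (C : R).
Variables (mom : 'I_r -> nat -> R).
Hypothesis my : forall u k, measurable_fun [set: T] (y u k).
Hypothesis yC : forall u k w, `|y u k w| <= C.
Hypothesis y_indep :
  independent_RVs P [set k : 'I_r * nat | (1 <= k.2)%N] (fun k => y k.1 k.2).
Hypothesis y_mom : forall u k n, (1 <= k)%N ->
  mean P (fun w => y u k w ^+ n) = mom u n.
Variables (q : nat) (c : q.-tuple 'I_r).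

Let L := limit_moment mom c.
Let K := closed_walk_sum (fun (_ : 'I_r) (_ : int) => C) c 0.
Let a w (u : 'I_r) (k : int) := y u `|k|%N w.

Let mom0 u : mom u 0 = 1.
Proof. by rewrite -(y_mom u 0 (leqnn 1)) -[RHS](mean_cst P). Qed.

Let by_ u k : bounded_mfun (y u k). Proof. by split=> //; exists C. Qed.

Let mean_edges (s : seq ('I_r * int)) : (forall k, k \in s -> 1 <= k.2) ->
  mean P (fun w => \prod_(k <- s) a w k.1 k.2) = joint_moment mom s.
Proof.
(* On labels at least 1 the absolute value is injective, and it lands in the index set where
   independence is assumed. *)
move=> s1; pose h (k : 'I_r * int) := (k.1, `|k.2|%N).
rewrite -(@joint_moment_map _ _ _ mom0 _ _ h)//; last first.
  move=> [u1 k1] [u2 k2] /s1 /= h1 /s1 /= h2 [-> kk]; congr (_, _); lia.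
rewrite -(mean_prod_joint_moment y_indep) => [|k|k n k1|_ /mapP[k ks ->]].
- by congr mean; apply/funext => w; rewrite big_map.
- exact: by_.
- exact: y_mom.
- by have := s1 _ ks; rewrite /=; lia.
Qed.

(** Labels of a [q]-step walk from [i] are at least [i - q], whence the starting height
    [(maxn p q).+1] in [Z] below. *)
Let edges_ge1 (i : int) e : q%:Z + 1 <= i ->
  forall k, k \in walk_edges i c e -> 1 <= k.2.
Proof. by move=> qi k /walk_edges_range; rewrite size_tuple; lia. Qed.

Let joint_moment_walk_edges i e :
  joint_moment mom (walk_edges i c e) = joint_moment mom (walk_edges 0 c e).
Proof.
rewrite walk_edges_add joint_moment_map// => -[u1 k1] [u2 k2] _ _ /= [-> kk].
by congr (_, _); lia.
Qed.

Let bounded_walk_weight i e : bounded_mfun (fun w => walk_weight (a w) i c e).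
Proof. by apply: bounded_mfun_prod => k _; exact: by_. Qed.

(* Below height [q] the walk would leave the model, so those few terms are
   replaced by the one at height [q], which makes the family stationary. *)
Let Z (p : nat) w := closed_walk_sum (a w) c (maxn p q).+1%:Z.

Let bZ p : bounded_mfun (Z p).
Proof. by apply: bounded_mfun_sum => e _; exact: bounded_walk_weight. Qed.

Let mean_Z p : mean P (Z p) = L.
Proof.
rewrite mean_sum => [|e _//]; apply: eq_bigr => e _.
rewrite mean_edges ?joint_moment_walk_edges//.
by apply: edges_ge1; lia.
Qed.

(** Walks of length [q] share no label once their starts are [2 * q] apart. The third [q] absorbs
    the replacement of [p] by [maxn p q], which is at most [p + q]. *)
Let mean_ZZ p p' : (p + 3 * q <= p')%N ->
  mean P (fun w => Z p w * Z p' w) = L * L.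
Proof.
move=> pp'; rewrite /Z /closed_walk_sum.
under eq_fun do rewrite mulr_suml.
rewrite mean_sum => [|e _]; last first.
  by apply: bounded_mfunM => //; apply: bounded_mfun_sum.
rewrite /L /limit_moment mulr_suml; apply: eq_bigr => e _.
under eq_fun do rewrite mulr_sumr.
rewrite mean_sum => [|e' _]; last exact: bounded_mfunM.
rewrite mulr_sumr; apply: eq_bigr => e' _.
under eq_fun do rewrite /walk_weight -big_cat.
rewrite mean_edges => [|k]; last first.
  by rewrite mem_cat => /orP[]; apply: edges_ge1; lia.
rewrite joint_moment_cat ?joint_moment_walk_edges// => k.
by move=> /walk_edges_range + /walk_edges_range; rewrite size_tuple; lia.
Qed.

Let ntrN (N : nat) w : R :=
  ntr (mx_word (fun u => tridiag (fun k => y u k w) N) c).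

Let Z_bound p w : `|Z p w| <= K.
Proof. by apply: closed_walk_sum_bound => u k; exact: yC. Qed.

Let cut_bound N w i :
  `|closed_walk_sum (cut_weights N (fun u k => y u k w)) c i| <= K.
Proof.
apply: closed_walk_sum_bound => u k; rewrite /cut_weights.
by case: ifP => _; rewrite ?normr0// (le_trans _ (yC u 0 w)).
Qed.

Lemma ntr_tridiag_bound N w : `|ntrN N w| <= K.
Proof.
have [->|N0] := posnP N.
  by rewrite /ntrN ntr_mx_word_walks invr0 mul0r normr0 (le_trans _ (Z_bound 0 w)).
rewrite /ntrN ntr_mx_word_walks normrM normfV normr_nat mulrC ler_pdivrMr ?ltr0n//.
rewrite (le_trans (ler_norm_sum _ _ _))//.
rewrite (le_trans (ler_sum _ (fun p _ => cut_bound N w _)))//.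
by rewrite sumr_const card_ord mulr_natr.
Qed.

(* Only the walks started within distance [q] of the ends feel the boundary. *)
Lemma ntr_tridiag_average N w : (0 < N)%N ->
  `|ntrN N w - L - N%:R^-1 * \sum_(p < N) (Z p w - L)| <= N%:R^-1 * (4 * q%:R * K).
Proof.
move=> N0; have N0' : N%:R != 0 :> R by rewrite pnatr_eq0 -lt0n.
have -> : ntrN N w - L - N%:R^-1 * \sum_(p < N) (Z p w - L) =
    N%:R^-1 * \sum_(p < N)
      (closed_walk_sum (cut_weights N (fun u k => y u k w)) c p.+1%:Z - Z p w).
  rewrite /ntrN ntr_mx_word_walks !sumrB sumr_const card_ord -mulr_natr.
  by field.
rewrite normrM normfV normr_nat ler_wpM2l ?invr_ge0//.
rewrite (le_trans (ler_norm_sum _ _ _))//.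
(* At most [q] starts are too low and at most [q] too high; each costs at most [2 * K], which gives
   the constant [4 * q * K]. *)
apply: (@le_trans _ _ (\sum_(p < N) ((p < q) + (N <= p + q))%N%:R * (2 * K))).
  apply: ler_sum => p _.
  have KK : `|closed_walk_sum (cut_weights N (fun u k => y u k w)) c p.+1%:Z
      - Z p w| <= 2 * K.
    rewrite (le_trans (ler_normB _ _))//.
    by have := cut_bound N w p.+1%:Z; have := Z_bound p w; lra.
  have K0 : 0 <= 2 * K := le_trans (normr_ge0 _) KK.
  have [pq|qp] := ltnP p q; first by rewrite (le_trans KK)// ler_peMl// ler1n.
  have [Np|pN] := leqP N (p + q); first by rewrite mul1r.
  (* Here [q <= p] and [p + q < N], so every label lies in [[1, N)], where cut weights and
     coefficients agree. *)
  rewrite mul0r [X in `|X|](_ : _ = 0) ?normr0//; apply/eqP; rewrite subr_eq0.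
  apply/eqP/eq_bigr => e _; rewrite (maxn_idPl qp).
  apply: eq_walk_weight => u k; rewrite size_tuple => hk.
  by rewrite /cut_weights ifT//; lia.
have K0 : 0 <= K := le_trans (normr_ge0 _) (Z_bound 0 w).
rewrite -mulr_suml -natr_sum big_split /=.
have h : ((\sum_(i < N) (i < q) + \sum_(i < N) (N <= i + q))%N%:R <= (q + q)%:R :> R).
  by rewrite ler_nat leq_add ?sum_ltn_ord ?sum_leq_addn_ord.
apply: le_trans (ler_wpM2r _ h) _; first by rewrite mulr_ge0.
by rewrite natrD; lra.
Qed.

Lemma ae_cvg_ntr_tridiag : {ae P, forall w, ntrN N w @[N --> \oo] --> L}.
Proof.
have : {ae P, forall w, n%:R^-1 * \sum_(p < n) (Z p w - L) @[n --> \oo] --> 0}.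
  apply: (@slln_weakly_dependent _ _ _ _ (fun p w => Z p w - L)
    (K + `|L|) (3 * q)) => [p|p w|p p' pp'].
  - by have [] := bounded_mfunB (bZ p) (bounded_mfun_cst L).
  - by rewrite (le_trans (ler_normB _ _))// lerD2r.
  - have bZZ := bounded_mfunM (bZ p) (bZ p').
    have -> : (fun w => (Z p w - L) * (Z p' w - L)) =
        (fun w => (Z p w * Z p' w + (- L) * (Z p w + Z p' w)) + L * L).
      by apply/funext => w; ring.
    have bZ' := bounded_mfunZ (- L) (bounded_mfunD (bZ p) (bZ p')).
    rewrite meanD; [|exact: bounded_mfunD|exact: bounded_mfun_cst].
    rewrite mean_cst meanD// meanZ; last exact: bounded_mfunD.
    by rewrite meanD// mean_ZZ// !mean_Z; ring.
apply: filterS => w /cvgr0Pnorm_lt av.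
apply/cvgrPdist_lt => eps eps0.
have [n0 _ h] := av _ (divr_gt0 eps0 (ltr0n R 2)).
pose M := 4 * q%:R * K.
(* The second threshold brings the boundary error [M / N] below [eps / 2], and its successor
   excludes [N = 0]. *)
exists (maxn n0 (Num.truncn (2 * M / eps)).+1) => // N /=.
rewrite geq_max => /andP[n0N MN].
have N0 : (0 < N)%N by exact: leq_ltn_trans MN.
have := h N n0N; have := ntr_tridiag_average w N0; rewrite -/M.
have : N%:R^-1 * M < eps / 2.
  have : 2 * M / eps < N%:R.
    by apply: lt_le_trans (truncnS_gt _) _; rewrite ler_nat.
  rewrite ltr_pdivrMr// => MNe.
  by rewrite mulrC ltr_pdivrMr ?ltr0n//; lra.
set t := ntrN N w; set A := N%:R^-1 * \sum_(p < N) _ => h1 h2 h3.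
rewrite distrC.
have := ler_normD (t - L - A) A; rewrite subrK; lra.
Qed.

Lemma cvg_expectation_ntr_tridiag : 'E_P[ntrN N]%E @[N --> \oo] --> L%:E.
Proof.
have [] := @dominated_convergence _ _ _ P [set: T] measurableT
  (fun N w => (ntrN N w)%:E) (fun=> L%:E) (fun=> K%:E).
- by move=> N; apply/measurable_EFinP; exact: measurable_ntr_mx_word.
- exact: measurable_cst.
- apply: filterS ae_cvg_ntr_tridiag => w cv _.
  by apply: cvg_EFin; [exact: nearW|exact: cv].
- exact: bounded_mfun_integrable (bounded_mfun_cst K).
- by apply: aeW => w N _; rewrite lee_fin ntr_tridiag_bound.
move=> _ _; rewrite integral_cst// [X in (_ * X)%E]probability_setT mule1 => h.
by rewrite unlock.
Qed.
End bounded_model.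

(** * From almost surely bounded coefficients to bounded ones *)

Lemma ae_forall_countable {d : measure_display} {T : measurableType d}
    {R : realType} (P : probability T R) (I : countType) (Q : I -> T -> Prop) :
  (forall i, {ae P, forall w, Q i w}) -> {ae P, forall w i, Q i w}.
Proof.
move=> Qae.
have : {ae P, forall w n, if @choice.unpickle I n is Some i then Q i w else True}.
  apply: ae_foralln => n; case: (choice.unpickle n) => [i|]; first exact: Qae.
  exact: aeW.
by apply: filterS => w h i; have := h (choice.pickle i); rewrite choice.pickleK.
Qed.

Section same_law_theory.
Context {d d' : measure_display} {T : measurableType d}
  {T' : measurableType d'} {R : realType}.
Variables (P : probability T R) (P' : probability T' R).
Variables (X : {RV P >-> R}) (Y : {RV P' >-> R}).
Hypothesis XY : same_law X Y.

(** The law alone decides whether a Borel condition holds almost surely. This carries the bound on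
    [b u 0] to every coefficient, including those of the model on the other space. *)
Lemma same_law_ae (A : set R) : measurable A ->
  {ae P', forall w, A (Y w)} -> {ae P, forall w, A (X w)}.
Proof.
move=> mA YA.
have mCA : measurable (~` A) by exact: measurableC.
have mX : measurable (X @^-1` (~` A)).
  by rewrite -[_ @^-1` _]setTI; exact: measurable_funP.
have mY : measurable (Y @^-1` (~` A)).
  by rewrite -[_ @^-1` _]setTI; exact: measurable_funP.
have Y0 : P' (Y @^-1` (~` A)) = 0%E.
  apply: (measure_negligible mY); exact: YA.
exists (X @^-1` (~` A)); split=> //.
by have := XY mCA; rewrite /distribution /pushforward Y0.
Qed.

Lemma same_law_mean (f : R -> R) : measurable_fun [set: R] f ->
  (exists M, forall t, `|f t| <= M) ->
  mean P (f \o X) = mean P' (f \o Y).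
Proof.
move=> mf [M fM].
have bX : bounded_mfun (f \o X).
  by split; [exact: measurableT_comp|exists M => w; exact: fM].
have bY : bounded_mfun (f \o Y).
  by split; [exact: measurableT_comp|exists M => w; exact: fM].
apply: EFin_inj; rewrite -!expectation_mean// unlock.
have mEf : measurable_fun [set: R] (EFin \o f) by exact/measurable_EFinP.
rewrite -(integral_distribution mEf (bounded_mfun_integrable P bX)).
rewrite -(integral_distribution mEf (bounded_mfun_integrable P' bY)).
by apply: eq_measure_integral => A mA _; exact: XY.
Qed.

End same_law_theory.

Section clamp.
Context {R : realType}.
Variables (C : R).

(** Being one fixed Borel function of each coefficient, truncation preserves independence and
    equality of laws; at level [C] it changes the coefficients only on a null set. *)
Definition clamp (t : R) : R := Num.max (- C) (Num.min C t).

Lemma clamp_bound t : 0 <= C -> `|clamp t| <= C.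
Proof.
move=> C0; rewrite ler_norml /clamp le_max lexx /= ge_max ge_min lexx /=.
by rewrite andbT; lra.
Qed.

Lemma clamp_id t : `|t| <= C -> clamp t = t.
Proof.
by rewrite ler_norml /clamp => /andP[h1 h2]; rewrite (min_idPr h2) (max_idPr h1).
Qed.

Lemma measurable_clamp : measurable_fun [set: R] clamp.
Proof. by apply: measurable_maxr => //; exact: measurable_minr. Qed.

End clamp.

(** Labels absent from [s] contribute [mom u 0 = 1], so the product over all integers reduces to the
    finitely many labels that occur. *)
Lemma joint_moment_fsbig (R : realType) (r : nat) (mom : 'I_r -> nat -> R)
    (s : seq ('I_r * int)) : (forall u, mom u 0 = 1) ->
  (\big[mule/1]_(i \in [set: int])
     \prod_(u < r) (mom u (count_mem (u, i) s))%:E)%E = (joint_moment mom s)%:E.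
Proof.
move=> mom0; under eq_fsbigr do rewrite prodEFin.
pose I0 := undup [seq k.2 | k <- s].
rewrite (@fsbigE _ _ _ _ _ I0) ?undup_uniq//; last first.
  move=> i _ iI0; rewrite big1// => u _; rewrite (count_memPn _) ?mom0//.
  by apply: contra iI0 => uis; rewrite mem_undup; apply/mapP; exists (u, i).
rewrite (eq_bigl xpredT) => [|i]; last by rewrite in_setT.
rewrite prodEFin; congr EFin.
rewrite (@joint_moment_widen _ _ _ mom0 _ s [seq (u, i) | u <- enum 'I_r, i <- I0]).
- rewrite big_allpairs big_enum /=.
  by rewrite exchange_big.
- by apply: allpairs_uniq; rewrite ?enum_uniq ?undup_uniq// => -[? ?] [? ?] _ _ [-> ->].
- move=> [u i] uis; apply/allpairsP; exists (u, i); rewrite mem_enum mem_undup.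
  by split=> //=; apply/mapP; exists (u, i).
Qed.

Theorem theorem4p3 (R : realType) (r : nat) (r_ge1 : (1 <= r)%N)
    (d : measure_display) (T : measurableType d) (P : probability T R)
    (b : 'I_r -> int -> {RV P >-> R})
    (b_bounded : forall u j, exists C : R, {ae P, forall w, `|b u j w| <= C})
    (b_iid : forall u, iid [set: int] (b u))
    (b_indep : independent_sequences P [set: int] (fun u j => b u j))
    (d' : measure_display) (T' : measurableType d') (P' : probability T' R)
    (x : 'I_r -> nat -> {RV P' >-> R})
    (x_iid : forall u, iid [set k | (1 <= k)%N] (x u))
    (x_law : forall u k, (1 <= k)%N -> same_law (x u k) (b u 0))
    (x_indep : independent_sequences P' [set k | (1 <= k)%N] (fun u k => x u k))
    (q : nat) (c : q.-tuple 'I_r) :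
  let J w u := jacobi (fun j => b u j w) in
  let X w N u := tridiag (fun k => x u k w) N in
  let limit := Phi P (fun w => op_word (J w) c) in
  [/\ 'E_P'[fun w => ntr (mx_word (X w N) c)]%E @[N --> \oo] --> limit,
      {ae P', forall w, (ntr (mx_word (X w N) c))%:E @[N --> \oo] --> limit},
      limit = (\sum_(g \in @closed_paths q)
                 \big[mule/1]_(i \in [set: int])
                   \prod_(u < r) 'E_P[fun w => (b u 0 w ^+ edge_count g c i u)%R])%E
    & forall g, closed_paths g ->
        finite_set [set iu : int * 'I_r |
          'E_P[fun w => (b iu.2 0 w ^+ edge_count g c iu.1 iu.2)%R]%E <> 1%E]].
Proof.
move=> J X limit.
have [C [C0 bC]] : exists C : R, 0 <= C /\
    forall u, {ae P, forall w, `|b u 0 w| <= C}.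
  have [f fP] := choice (fun u => b_bounded u 0).
  (* There are finitely many colours, so one constant dominates all their bounds; nonnegativity is
     what [clamp_bound] asks for. *)
  exists (\sum_u `|f u|); split; first exact: sumr_ge0.
  move=> u; apply: filterS (fP u) => w /le_trans; apply.
  by rewrite (le_trans (ler_norm _))// (bigD1 u) //= lerDl sumr_ge0.
have mC : measurable [set t : R | `|t| <= C].
  have := @normr_measurable R setT measurableT `]-oo, C]%classic (measurable_itv _).
  by rewrite setTI; congr measurable; apply/seteqP; split=> t /=; rewrite in_itv.
(* Equality of laws makes the bound at index 0 valid at every index, and countability allows one
   null set for all. *)
have bC' : {ae P, forall w (k : 'I_r * int), `|b k.1 k.2 w| <= C}.
  apply: ae_forall_countable => -[u j] /=.
  exact: (same_law_ae ((b_iid u).2 j 0 I I) mC (bC u)).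
have xC' : {ae P', forall w (k : 'I_r * nat), (1 <= k.2)%N -> `|x k.1 k.2 w| <= C}.
  apply: ae_forall_countable => -[u k] /=.
  have [k1|_] := leqP 1 k; last exact: aeW.
  by apply: filterS (same_law_ae (x_law u k k1) mC (bC u)) => w + _.
have mclamp (f : nat) : measurable_fun [set: R] (fun t => clamp C t ^+ f).
  by apply: measurable_funX; exact: measurable_clamp.
have bclamp (n : nat) : exists M : R, forall t, `|clamp C t ^+ n| <= M.
  exists (C ^+ n) => t; rewrite normrX.
  by apply: lerXn2r; rewrite ?nnegrE// clamp_bound.
pose mom u n := mean P (fun w => clamp C (b u 0 w) ^+ n).
have mom0 u : mom u 0 = 1 by rewrite /mom -[RHS](mean_cst P).
have mv u j : measurable_fun [set: T] (fun w => clamp C (b u j w)).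
  by apply: measurableT_comp => //; exact: measurable_clamp.
have E_mom u n : 'E_P[fun w => (b u 0 w ^+ n)%R]%E = (mom u n)%:E.
  rewrite -expectation_mean; last first.
    split; first exact: measurable_funX.
    by have [M hM] := bclamp n; exists M => w; exact: hM.
  apply: ae_eq_expectation; [exact: measurable_funX..|].
  by apply: filterS (bC u) => w h; rewrite clamp_id.
pose y u k w := clamp C (x u k w).
pose v (k : 'I_r * int) w := clamp C (b k.1 k.2 w).
have my u k : measurable_fun [set: T'] (y u k).
  by apply: measurableT_comp => //; exact: measurable_clamp.
have bv k : bounded_mfun (v k).
  split; first exact: mv.
  by exists C => w; exact: clamp_bound.
have v_indep : independent_RVs P [set k : 'I_r * int | [set: int] k.2] v.
  apply: (independent_RVs_comp (X := fun k => b k.1 k.2)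
    (fun=> measurable_clamp C)).
  apply: (independent_RVs_joint (X := fun u j => b u j)) b_indep => u.
  exact: (b_iid u).1.
have y_indep : independent_RVs P' [set k : 'I_r * nat | (1 <= k.2)%N]
    (fun k => y k.1 k.2).
  apply: (independent_RVs_comp (X := fun k => x k.1 k.2)
    (fun=> measurable_clamp C)).
  apply: (independent_RVs_joint (X := fun u k => x u k)) x_indep => u.
  exact: (x_iid u).1.
have limitE : limit = (limit_moment mom c)%:E.
  rewrite /limit /Phi.
  under [X in expectation _ X]eq_fun do rewrite jacobi_word_closed_walks.
  (* The walk sum is unchanged almost surely by truncation, and the truncated one has an everywhere
     bound, so its mean splits over walks. *)
  rewrite (@ae_eq_expectation _ _ _ _ _
    (fun w => closed_walk_sum (fun u j => v (u, j) w) c 0)).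
  - rewrite expectation_mean; last first.
      by apply: bounded_mfun_sum => e _; apply: bounded_mfun_prod => k _; exact: bv.
    congr EFin; rewrite mean_sum => [|e _]; last first.
      by apply: bounded_mfun_prod => k _; exact: bv.
    apply: eq_bigr => e _; rewrite -(mean_prod_joint_moment v_indep)//.
    move=> [u j] n _ /=.
    exact: (same_law_mean ((b_iid u).2 j 0 I I) (mclamp n) (bclamp n)).
  - by apply: measurable_closed_walk_sum.
  - by apply: measurable_closed_walk_sum => u k; case: (bv (u, k)).
  - apply: filterS bC' => w h; apply: eq_bigr => e _.
    by apply: eq_walk_weight => u k _; rewrite /v clamp_id//; exact: (h (u, k)).
have yC u k w : `|y u k w| <= C by exact: clamp_bound.
have y_mom u k n : (1 <= k)%N -> mean P' (fun w => y u k w ^+ n) = mom u n.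
  move=> k1; exact: (same_law_mean (x_law u k k1) (mclamp n) (bclamp n)).
have xy : {ae P', forall w N, ntr (mx_word (X w N) c) =
    ntr (mx_word (fun u => tridiag (fun k => y u k w) N) c)}.
  apply: filterS xC' => w h N; rewrite !ntr_mx_word_walks.
  congr (_ * _); apply: eq_bigr => p _; apply: eq_bigr => e _.
  (* The guard in the cut weights supplies [1 <= k], the range on which [x] is known to be
     bounded. *)
  apply: eq_walk_weight => u k _; rewrite /cut_weights; case: ifP => // /andP[k1 _].
  by rewrite /y clamp_id//; apply: (h (u, _)) => /=; lia.
split.
- rewrite limitE.
  rewrite (_ : (fun N => _) = fun N =>
    'E_P'[fun w => ntr (mx_word (fun u => tridiag (fun k => y u k w) N) c)]%E).
    exact: (cvg_expectation_ntr_tridiag my yC y_indep y_mom).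
  apply/funext => N; apply: ae_eq_expectation.
  + exact: measurable_ntr_mx_word.
  + exact: measurable_ntr_mx_word.
  + by apply: filterS xy => w.
- rewrite limitE.
  apply: filterS2 xy (ae_cvg_ntr_tridiag my yC y_indep y_mom c) => w xyw cv.
  apply: cvg_EFin; first exact: nearW.
  by rewrite /comp /=; under eq_fun do rewrite xyw.
- rewrite limitE fsbig_closed_paths /limit_moment size_tuple -sumEFin.
  rewrite big_seq_cond [RHS]big_seq_cond; apply: eq_bigr => e /andP[].
  rewrite mem_sign_words => /eqP se _.
  rewrite -joint_moment_fsbig//; apply: eq_fsbigr => i _; apply: eq_bigr => u _.
  by rewrite edge_countE// E_mom.
- move=> g; rewrite closed_pathsE /= => /mapP[e].
  rewrite mem_filter mem_sign_words => /andP[_ /eqP se] ->.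
  (* Only pairs met by the walk have a positive exponent; the components are swapped because walk
     labels put the colour first. *)
  apply: (@sub_finite_set _ _ [set` [seq (k.2, k.1) | k <- walk_edges 0 c e]]).
    move=> [i u] /=; rewrite edge_countE// => Eiu.
    apply: contrapT => niu; apply: Eiu; rewrite (count_memPn _) ?E_mom ?mom0//.
    by apply/negP => uie; apply: niu; apply/mapP; exists (u, i).
  exact: finite_seq.
Qed.
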